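(* Consider the system with state $\chi=(y,x)\in\mathbb{R}^{n_y}\times\mathbb{R}$, $n=n_y+1$, and input $u\in\mathbb{R}^p$, $$\dot y=h_1(y)+h_2(y)x,\qquad \dot x=f(y,x)+g(y,x)u,$$ where $h_1,h_2:\mathbb{R}^{n_y}\to\mathbb{R}^{n_y}$, $f:\mathbb{R}^{n}\to\mathbb{R}$ and $g:\mathbb{R}^{n}\to\mathbb{R}^{1\times p}$ are $C^1$, $h_1(0)=0$, $f(0,0)=0$, and $g(y,x)\neq0$ for all $(y,x)$. Put $$A=\begin{bmatrix} H_1 & H_2 \\ F_1 & F_2 \end{bmatrix},\qquad B=\begin{bmatrix} 0 \\ G \end{bmatrix},$$ with $H_1=\frac{\partial h_1}{\partial y}(0)$, $H_2=h_2(0)$, $F_1=\frac{\partial f}{\partial y}(0,0)$, $F_2=\frac{\partial f}{\partial x}(0,0)$, $G=g(0,0)$. Assume that for every couple $(K_y,P_y)$, with $K_y\in\mathbb{R}^{1\times n_y}$ and $P_y\in\mathbb{R}^{n_y\times n_y}$ a positive definite matrix, such that $$P_y(H_1+H_2K_y)+(H_1+H_2K_y)'P_y<0,$$ there exists a smooth, proper, positive definite function $V_y:\mathbb{R}^{n_y}\to\mathbb{R}_+$ such that $H(V_y)(0)=2P_y$ and such that for all $y\neq0$, $$L_{h_2}V_y(y)=0\ \Rightarrow\ L_{h_1}V_y(y)<0 .$$ Let $K_o\in\mathbb{R}^{p\times n}$ be a matrix such that $A+BK_o$ is Hurwitz. Then there exists a smooth function $\alpha_o:\mathbb{R}^n\to\mathbb{R}^p$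 which solves the global asymptotic stabilization with prescribed local behavior problem for $K_o$; that is, the origin of the closed-loop system obtained with $u=\alpha_o(y,x)$ is globally asymptotically stable, and $\frac{\partial\alpha_o}{\partial\chi}(0)=K_o$.
   Context: A prime denotes transpose; $M<0$ for a symmetric matrix means negative definite. A matrix is Hurwitz if all its eigenvalues have negative real part. $H(V_y)(0)$ is the Hessian matrix of $V_y$ at $0$. For a vector field $h$ on $\mathbb{R}^{n_y}$, $L_hV_y(y)=\frac{\partial V_y}{\partial y}(y)h(y)$. A function $V_y$ is positive definite if $V_y(0)=0$ and $V_y(y)>0$ for $y\ne0$; it is proper if preimages of compact sets are compact. *)

(* Defs.v *)
From HB Require Import structures.
From mathcomp Require Export all_boot all_order all_algebra.
From mathcomp Require Export all_classical all_reals all_analysis.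
From mathcomp Require Export complex.

Set Implicit Arguments.
Unset Strict Implicit.
Unset Printing Implicit Defensive.

Export Order.TTheory GRing.Theory Num.Theory.
Export numFieldNormedType.Exports.

#[export] Set Implicit Arguments.
#[export] Unset Strict Implicit.
#[export] Unset Printing Implicit Defensive.

Local Open Scope classical_set_scope.
Local Open Scope ring_scope.

(* Class C^k for maps out of a finite-dimensional space: f is C^(k+1) when it
   is differentiable and all its directional derivatives are C^k. *)
Fixpoint Ck (R : realType) (V W : normedModType R) (k : nat) (f : V -> W)
    : Prop :=
  match k with
  | 0 => continuous f
  | k'.+1 => (forall a, differentiable f a) /\
             (forall v, Ck k' (fun a => 'D_v f a))
  end.

Definition smooth (R : realType) (V W : normedModType R) (f : V -> W) : Prop :=
  forall k, Ck k f.

(* Vectors are columns, and (jac f a) i j is the partial derivative of the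
   i-th component with respect to the j-th coordinate. The library's 'J acts on
   row vectors and is the transpose of this matrix. *)
Definition jac (R : realType) (n m : nat) (f : 'cV[R]_n -> 'cV[R]_m)
    (a : 'cV[R]_n) : 'M[R]_(m, n) :=
  \matrix_(i, j) 'D_(delta_mx j 0) f a i 0.

Definition grad (R : realType) (n : nat) (f : 'cV[R]_n -> R) (a : 'cV[R]_n)
    : 'rV[R]_n :=
  \row_j 'D_(delta_mx j 0) f a.

Definition hessian (R : realType) (n : nat) (f : 'cV[R]_n -> R) (a : 'cV[R]_n)
    : 'M[R]_n :=
  \matrix_(i, j) 'D_(delta_mx i 0) (fun b => 'D_(delta_mx j 0) f b) a.

Definition lie (R : realType) (n : nat) (h : 'cV[R]_n -> 'cV[R]_n)
    (V : 'cV[R]_n -> R) (y : 'cV[R]_n) : R :=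
  (grad V y *m h y) 0 0.

Definition posdef_mx (R : realType) (n : nat) (M : 'M[R]_n) : Prop :=
  M^T = M /\ forall v : 'cV[R]_n, v != 0 -> 0 < (v^T *m M *m v) 0 0.

Definition negdef_mx (R : realType) (n : nat) (M : 'M[R]_n) : Prop :=
  M^T = M /\ forall v : 'cV[R]_n, v != 0 -> (v^T *m M *m v) 0 0 < 0.

Definition hurwitz (R : realType) (n : nat) (M : 'M[R]_n) : Prop :=
  forall l : R[i], eigenvalue (map_mx (real_complex R) M) l ->
    complex.Re l < 0.

Definition posdef_fun (R : realType) (n : nat) (V : 'cV[R]_n -> R) : Prop :=
  V 0 = 0 /\ forall y, y != 0 -> 0 < V y.

Definition proper_fun (R : realType) (n : nat) (V : 'cV[R]_n -> R) : Prop :=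
  forall K : set R, compact K -> compact (V @^-1` K).

(* Only the restriction of chi to [0, T[ matters. *)
Definition solution (R : realType) (n : nat) (F : 'cV[R]_n -> 'cV[R]_n)
    (T : \bar R) (chi : R -> 'cV[R]_n) : Prop :=
  {within [set t : R | 0 <= t /\ (t%:E < T)%E], continuous chi} /\
  forall t : R, 0 < t -> (t%:E < T)%E -> is_derive t 1 chi (F (chi t)).

(* Global asymptotic stability of the origin for chi' = F chi with F locally
   Lipschitz, so that solutions are unique: every initial condition has a
   solution on [0, +oo[, the origin is stable, and it attracts all solutions. *)
Definition GAS (R : realType) (n : nat) (F : 'cV[R]_n -> 'cV[R]_n) : Prop :=
  [/\ forall chi0, exists2 chi, solution F +oo%E chi & chi 0 = chi0,
      forall e : R, 0 < e -> exists2 d : R, 0 < d &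
        forall T chi, (0 < T)%E -> solution F T chi -> `|chi 0| < d ->
          forall t : R, 0 <= t -> (t%:E < T)%E -> `|chi t| < e &
      forall chi, solution F +oo%E chi -> chi t @[t --> +oo] --> (0 : 'cV[R]_n)].

Section System.
Variables (R : realType) (ny p : nat).
Variables (h1 h2 : 'cV[R]_ny -> 'cV[R]_ny).
Variables (f : 'cV[R]_(ny + 1) -> R) (g : 'cV[R]_(ny + 1) -> 'rV[R]_p).

(* The state is the column chi = (y, x), with y = usubmx chi and
   x = dsubmx chi 0 0. *)
Definition system (chi : 'cV[R]_(ny + 1)) (u : 'cV[R]_p) : 'cV[R]_(ny + 1) :=
  let y := usubmx chi in
  let x := dsubmx chi 0 0 in
  col_mx (h1 y + x *: h2 y) (f chi + (g chi *m u) 0 0)%:M.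

Definition sysA : 'M[R]_(ny + 1) :=
  block_mx (jac h1 0) (h2 0) (lsubmx (grad f 0)) (rsubmx (grad f 0)).

Definition sysB : 'M[R]_(ny + 1, p) := col_mx 0 (g 0).

Definition prescribed_local_GAS (Ko : 'M[R]_(p, ny + 1))
    (alpha : 'cV[R]_(ny + 1) -> 'cV[R]_p) : Prop :=
  GAS (fun chi => system chi (alpha chi)) /\ jac alpha 0 = Ko.

End System.

(* Main.v *)
Require Import Defs.
From HB Require Import structures.
From mathcomp Require Import ring lra.

(** * Global stabilizers with a prescribed linear part

    The Hurwitz matrix M = A + B Ko has a quadratic Lyapunov function given by a
    matrix P ([lyapunov_equation]). Completing the square in x writes the form
    of P as y'Py y + p (x - Ky y)^2 ([schur_complement]), and on the subspace
    x = Ky y the form of PM + M'P is that of Py (H1 + H2 Ky) + (H1 + H2 Ky)'Py.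
    So (Ky, Py) is one of the couples of the assumption, which provides a
    control Lyapunov function Vy of the y-subsystem with Hessian 2 Py.

    The two remaining constructions rest on the same principle
    ([smooth_selection]). Let the inequality a + b u < 0 have a solution u at
    each point other than the origin, and let the linear input u = K z solve it
    at all points z near the origin. As the inequality is convex in u, a
    partition of unity glues local solutions into a smooth one that coincides
    with K z near the origin.

    Applied to y, with x as the input, this gives a smooth function phi with
    linear part Ky such that Vy decreases along the y-subsystem with x = phi(y)
    ([smooth_virtual_control]). Then V = Vy(y) + p (x - phi(y))^2 is smooth,
    proper, positive definite, and has Hessian 2P, by the choice of p, Ky and
    Py. Consequently u = Ko chi decreases V near the origin ([local_decrease]).
    Elsewhere, the input acts on V with coefficient 2 p (x - phi(y)) g; since g
    has no zero, it is powerless only where x = phi(y), and there V decreases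
    because Vy does. A second selection yields a smooth alpha that decreases V
    everywhere and coincides with Ko chi near the origin.

    Lyapunov's direct method concludes ([gas_of_lyapunov]). The existence of
    global trajectories is part of the claim; it comes from Picard iteration
    ([picard_global]) for the field cut off outside a sublevel set of V. *)

Local Open Scope classical_set_scope.
Local Open Scope ring_scope.

(** * Differentiability and the classes C^k *)

Section Differentiability.
Variables (R : realType).
Implicit Types (V W : normedModType R).

Lemma differentiable_approx V W (f : V -> W) (x : V) : differentiable f x ->
  forall e : R, 0 < e ->
    \forall h \near (0 : V), `|f (x + h) - f x - 'd f x h| <= e * `|h|.
Proof.
move=> /diff_locally /eqaddoP fx e /fx; apply: filterS => h /=.
by rewrite !fctE /= [h + x]addrC opprD addrA.
Qed.

Lemma differentiable_of_approx V W (f : V -> W) (L : {linear V -> W}) (x : V) :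
  continuous L ->
  (forall e : R, 0 < e ->
    \forall h \near (0 : V), `|f (x + h) - f x - L h| <= e * `|h|) ->
  differentiable f x.
Proof.
move=> Lc fx.
have E : f \o shift x = cst (f x) + L +o_ 0 id.
  apply/eqaddoP => e /fx; apply: filterS => h /=.
  by rewrite !fctE /= [h + x]addrC opprD addrA.
by apply/diff_locallyP; rewrite (diff_unique Lc E).
Qed.

(** The differential is picked by a choice operator, which may depend on values
    far from x; the estimate that characterizes it does not. *)
Lemma near_eq_differentiable V W (f g : V -> W) (x : V) :
  (\near x, f x = g x) -> differentiable g x -> differentiable f x.
Proof.
move=> fg gx; apply: (@differentiable_of_approx _ _ _ ('d g x)).
  exact: diff_continuous.
move=> e e0; have fgx := nbhs_singleton fg.
have : \forall h \near (0 : V), f (x + h) = g (x + h).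
  move/nbhs_normP: fg => [d d0 fg]; apply/nbhs_normP; exists d => // h /=.
  by rewrite sub0r normrN => hd; apply: fg; rewrite /= opprD addNKr normrN.
apply: filter_app; apply: filter_app (differentiable_approx gx e0).
by apply: nearW => h /= H ->; rewrite fgx.
Qed.

End Differentiability.

Section CkCalculus.
Variables (R : realType).
Implicit Types (U V W : normedModType R).

Lemma eq_Ck V W k (g f : V -> W) : f =1 g -> Ck k g -> Ck k f.
Proof. by move=> /funext ->. Qed.

Lemma CkW V W k (f : V -> W) : Ck k.+1 f -> Ck k f.
Proof.
elim: k f => [|k IH] f [df Df]; first by move=> x; exact: differentiable_continuous.
by split=> // v; apply/IH/Df.
Qed.

Lemma Ck_continuous V W k (f : V -> W) : Ck k f -> continuous f.
Proof. by elim: k => // k IH /CkW. Qed.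

Lemma Ck_cst V W k (c : W) : Ck k (fun _ : V => c).
Proof.
elim: k c => [|k IH] c; first exact: cst_continuous.
split=> [a|v]; first exact: differentiable_cst.
apply: (@eq_Ck _ _ _ (fun=> 0)); last exact: IH.
by move=> a; exact: derive_cst.
Qed.

Lemma Ck_linear V W k (f : {linear V -> W}) : continuous f -> Ck k f.
Proof.
case: k => [//|k] fc; split=> [a|v]; first exact: linear_differentiable.
apply: (@eq_Ck _ _ _ (fun=> f v)); last exact: Ck_cst.
move=> a; rewrite deriveE; last exact: linear_differentiable.
by rewrite diff_lin.
Qed.

Lemma CkD V W k (f g : V -> W) : Ck k f -> Ck k g -> Ck k (fun x => f x + g x).
Proof.
elim: k f g => [|k IH] f g.
  by move=> fc gc x; apply: cvgD; [exact: fc|exact: gc].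
move=> [df Df] [dg Dg]; split=> [a|v]; first exact: differentiableD.
apply: (@eq_Ck _ _ _ (fun a => 'D_v f a + 'D_v g a)).
  by move=> a; apply: deriveD; exact: diff_derivable.
by apply: IH; [exact: Df|exact: Dg].
Qed.

Lemma Ck_sum V W k (I : Type) (s : seq I) (F : I -> V -> W) :
  (forall i, Ck k (F i)) -> Ck k (fun x => \sum_(i <- s) F i x).
Proof.
move=> HF; elim: s => [|i s IH].
  by under eq_fun do rewrite big_nil; exact: Ck_cst.
by under eq_fun do rewrite big_cons; exact: CkD.
Qed.

(** In finite dimension a linear map is a finite sum of multiples of
    coordinates. *)
Lemma linear_mx_continuous m n W (f : 'M[R]_(m, n) -> W) :
  linear f -> continuous f.
Proof.
move=> lf; pose fL : {linear _ -> _} := HB.pack f (GRing.isLinear.Build _ _ _ _ _ lf).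
have -> : f = fun v => \sum_i \sum_j v i j *: f (delta_mx i j).
  apply: funext => v; rewrite [in LHS](matrix_sum_delta v) -[f]/(fL : _ -> _).
  rewrite linear_sum; apply: eq_bigr => i _.
  by rewrite linear_sum; apply: eq_bigr => j _; rewrite linearZ.
apply: (@Ck_sum _ _ 0) => i; apply: (@Ck_sum _ _ 0) => j v.
exact: (@continuousZr_tmp _ _ _ (fun M : 'M[R]_(m,
  n) => M i j) _ v (@coord_continuous _ _ _ i j v)).
Qed.

Lemma Ck_linear_mx m n W k (f : 'M[R]_(m, n) -> W) : linear f -> Ck k f.
Proof.
move=> lf; pose fL : {linear _ -> _} := HB.pack f (GRing.isLinear.Build _ _ _ _ _ lf).
by apply: (@Ck_linear _ _ k fL); exact: linear_mx_continuous.
Qed.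

Lemma CkM V k (f g : V -> R) : Ck k f -> Ck k g -> Ck k (fun x => f x * g x).
Proof.
elim: k f g => [|k IH] f g.
  by move=> fc gc x; apply: cvgM; [exact: fc|exact: gc].
move=> fk gk; split=> [a|v].
  by apply: differentiableM; [exact: fk.1|exact: gk.1].
apply: (@eq_Ck _ _ _ (fun a => f a * 'D_v g a + g a * 'D_v f a)); last first.
  by apply: CkD; apply: IH; do ?[exact: CkW|exact: (gk.2 v)|exact: (fk.2 v)].
by move=> a; apply: deriveM; apply: diff_derivable; [exact: fk.1|exact: gk.1].
Qed.

Lemma Ck_comp_linear U V W k (f : U -> V) (L : {linear V -> W}) :
  continuous L -> Ck k f -> Ck k (fun x => L (f x)).
Proof.
move=> Lc; elim: k f => [|k IH] f; first by move=> fc x;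
  exact: (@continuous_comp _ _ _ f L x (fc x) (Lc _)).
have Ld x : differentiable L x by exact: linear_differentiable.
move=> [df Df]; split=> [a|v]; first exact: (differentiable_comp (df a) (Ld _)).
apply: (@eq_Ck _ _ _ (fun a => L ('D_v f a))); last by apply: IH; exact: Df.
move=> a.
rewrite !deriveE //; last exact: (differentiable_comp (df a) (Ld _)).
by rewrite (diff_comp (df a) (Ld _)) diff_lin.
Qed.

Lemma Ck_linear_comp U V W k (L : {linear U -> V}) (f : V -> W) :
  continuous L -> Ck k f -> Ck k (fun x => f (L x)).
Proof.
move=> Lc; elim: k f => [|k IH] f; first by move=> fc x;
  exact: (@continuous_comp _ _ _ L f x (Lc _) (fc _)).
have Ld x : differentiable L x by exact: linear_differentiable.
move=> [df Df]; split=> [a|v]; first exact: (differentiable_comp (Ld a) (df _)).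
apply: (@eq_Ck _ _ _ (fun a => 'D_(L v) f (L a))); last exact: (IH _ (Df (L v))).
move=> a.
rewrite !deriveE //; last exact: (differentiable_comp (Ld a) (df _)).
by rewrite (diff_comp (Ld _) (df (L a))) diff_lin.
Qed.

Lemma Ck_scalel V W k (f : V -> R) (c : W) : Ck k f -> Ck k (fun x => f x *: c).
Proof.
have sx_lin : linear ( *:%R ^~ c : R -> _) by move=> u y z; rewrite scalerDl scalerA.
pose L : {linear _ -> _} := HB.pack ( *:%R ^~ c) (GRing.isLinear.Build _ _ _ _ _ sx_lin).
by apply: (@Ck_comp_linear _ _ _ k f L); exact: scalel_continuous.
Qed.

(** A matrix is a finite combination of constant matrices whose coefficients are
    its entries, which reduces matrix-valued maps to scalar ones. *)
Lemma Ck_mx V m n k (M : V -> 'M[R]_(m, n)) :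
  (forall i j, Ck k (fun x => M x i j)) -> Ck k M.
Proof.
move=> HM.
rewrite (_ : M = fun x => \sum_i \sum_j M x i j *: delta_mx i j).
  by apply: Ck_sum => i; apply: Ck_sum => j; exact: Ck_scalel.
by apply: funext => x; exact: matrix_sum_delta.
Qed.

Lemma Ck_coord V m n k (M : V -> 'M[R]_(m, n)) i j :
  Ck k M -> Ck k (fun x => M x i j).
Proof.
have cl : linear (fun N : 'M[R]_(m, n) => N i j) by move=> u y z; rewrite !mxE.
pose L : {linear _ -> _} :=
  HB.pack (fun N : 'M[R]_(m, n) => N i j) (GRing.isLinear.Build _ _ _ _ _ cl).
by apply: (@Ck_comp_linear _ _ _ k M L); exact: coord_continuous.
Qed.

Lemma Ck_mulmx V m n p k (M : V -> 'M[R]_(m, n)) (N : V -> 'M[R]_(n, p)) :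
  Ck k M -> Ck k N -> Ck k (fun x => M x *m N x).
Proof.
move=> HM HN; apply: Ck_mx => i j.
under eq_fun do rewrite mxE.
by apply: Ck_sum => l; apply: CkM; exact: Ck_coord.
Qed.

Lemma CkZ V m n k (f : V -> R) (M : V -> 'M[R]_(m, n)) :
  Ck k f -> Ck k M -> Ck k (fun x => f x *: M x).
Proof.
move=> Hf HM; apply: Ck_mx => i j.
by under eq_fun do rewrite mxE; apply: CkM => //; exact: Ck_coord.
Qed.

Lemma CkN V W k (f : V -> W) : Ck k f -> Ck k (fun x => - f x).
Proof.
by apply: (@Ck_comp_linear _ _ _ k f (-%R : {linear W -> W})); exact: opp_continuous.
Qed.

Lemma CkB V W k (f g : V -> W) : Ck k f -> Ck k g -> Ck k (fun x => f x - g x).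
Proof. by move=> Hf Hg; apply: CkD => //; exact: CkN. Qed.

(** The derivative of the inverse of f is a product of lower order inverses and
    of a derivative of f, whence the induction. *)
Lemma CkV V k (f : V -> R) :
  (forall x, f x != 0) -> Ck k f -> Ck k (fun x => (f x)^-1).
Proof.
move=> f0; elim: k => [|k IH] Hf; first by move=> x; apply: cvgV => //; exact: Hf.
have Hfk := CkW Hf.
split=> [a|v]; first by apply: differentiableV => //; exact: Hf.1.
apply: (@eq_Ck _ _ _ (fun a => - ((f a)^-1 * (f a)^-1 * 'D_v f a))); last first.
  by apply/CkN/CkM; [apply: CkM; exact: IH|exact: (Hf.2 v)].
move=> a; rewrite deriveV //; last by apply: diff_derivable; exact: Hf.1.
by rewrite scaleNr expr2 invfM.
Qed.

(** Only outer functions of one variable are composed: the direction of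
    differentiation stays constant and the chain rule is a product. *)
Lemma Ck_comp_real V k (s : R -> R) (f : V -> R) :
  Ck k s -> Ck k f -> Ck k (fun x => s (f x)).
Proof.
elim: k s => [|k IH] s.
  by move=> sc fc x; apply: continuous_comp; [exact: fc|exact: sc].
move=> [ds Ds] Hf; have df := Hf.1; split=> [a|v];
  first exact: (differentiable_comp (df a) (ds _)).
apply: (@eq_Ck _ _ _ (fun a => 'D_1 s (f a) * 'D_v f a)); last first.
  by apply: CkM; [exact: (IH _ (Ds 1) (CkW Hf))|exact: (Hf.2 v)].
move=> a.
rewrite deriveE; last exact: (differentiable_comp (df a) (ds _)).
rewrite diff_comp //= !deriveE // -[X in 'd s _ X]mulr1.
by rewrite -[_ * 1]/(_ *: 1) linearZ mulrC.
Qed.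

(** Lets sums of infinitely many functions be differentiated when the family is
    locally finite. *)
Lemma Ck_local V W k (f : V -> W) :
  (forall a : V, exists2 g : V -> W, Ck k g & \forall b \near a, f b = g b) -> Ck k f.
Proof.
elim: k f => [|k IH] f Hf.
  move=> a; have [g gc fg] := Hf a.
  rewrite /continuous_at (nbhs_singleton fg).
  by apply: cvg_trans (gc a); apply: near_eq_cvg; apply: filterS fg => x ->.
split=> [a|v].
  by have [g gc fg] := Hf a; apply: near_eq_differentiable fg _; exact: gc.1.
apply: IH => a; have [g gc fg] := Hf a.
exists ('D_v g); first exact: (gc.2 v).
move: (near_join fg); apply: filterS => b Hb; exact: near_eq_derive.
Qed.

End CkCalculus.

Section Coordinates.
Variable R : realType.

Lemma is_derive_curve (V W : normedModType R) (chi : R -> V) (f : V -> W) (t : R) (v : V) :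
  is_derive t 1 chi v -> differentiable f (chi t) ->
  is_derive t 1 (fun s => f (chi s)) ('d f (chi t) v).
Proof.
move=> dchi df.
have dc : differentiable chi t.
  by apply/derivable1_diffP; exact: (@ex_derive _ _ _ _ _ _ _ dchi).
have dfc := differentiable_comp dc df.
apply: DeriveDef; first exact/derivable1_diffP.
have <- : 'd chi t 1 = v by rewrite -deriveE // (@derive_val _ _ _ _ _ _ _ dchi).
by rewrite deriveE // diff_comp.
Qed.

Lemma is_derive_line (V : normedModType R) (w : V) (t : R) : is_derive t 1 (fun s : R => s *: w) w.
Proof.
have d := is_diff_scalel t w.
apply: DeriveDef; first by apply/derivable1_diffP; exact: (@ex_diff _ _ _ _ _ _ _ d).
rewrite deriveE; last exact: (@ex_diff _ _ _ _ _ _ _ d).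
by rewrite diff_val scale1r.
Qed.

Lemma is_derive_coord (V : normedModType R) m n (M : V -> 'M[R]_(m, n)) a v i j :
  differentiable M a -> is_derive a v (fun x => M x i j) ('D_v M a i j).
Proof.
move=> dM; have dv := diff_derivable (v := v) dM.
apply: DeriveDef; first exact: (derivable_mxP _ _ _).1 dv i j.
by rewrite derive_mx // mxE.
Qed.

Lemma diff_delta_sum n (W : normedModType R) (f : 'cV[R]_n -> W) (x v : 'cV[R]_n) :
  differentiable f x -> 'd f x v = \sum_j v j 0 *: 'D_(delta_mx j 0) f x.
Proof.
move=> df; rewrite [in LHS](matrix_sum_delta v) linear_sum; apply: eq_bigr => j _.
by rewrite big_ord1 linearZ /= deriveE.
Qed.

Lemma derive_jac m n (F : 'cV[R]_n -> 'cV[R]_m) a v : differentiable F a ->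
  'D_v F a = jac F a *m v.
Proof.
move=> dF; rewrite deriveE // diff_delta_sum //; apply/matrixP => i j.
by rewrite (ord1 j) summxE mxE; apply: eq_bigr => k _; rewrite !mxE mulrC.
Qed.

Lemma derive_grad n (F : 'cV[R]_n -> R) a v : differentiable F a ->
  'D_v F a = (grad F a *m v) 0 0.
Proof.
move=> dF; rewrite deriveE // diff_delta_sum // mxE.
by apply: eq_bigr => k _; rewrite !mxE mulrC.
Qed.

Lemma derive_mulmxl n m (K : 'M[R]_(m, n)) (a v : 'cV[R]_n) :
  'D_v (fun x => K *m x) a = K *m v.
Proof.
have lK : linear (fun x : 'cV[R]_n => K *m x) by move=> c x y; rewrite mulmxDr scalemxAr.
pose L : {linear _ -> _} :=
  HB.pack (fun x : 'cV[R]_n => K *m x) (GRing.isLinear.Build _ _ _ _ _ lK).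
have Lc : continuous L := linear_mx_continuous lK.
by rewrite deriveE ?(@diff_lin _ _ _ L) //; exact: (@linear_differentiable _ _ _ L).
Qed.

Lemma derive_near_linear n m (F : 'cV[R]_n -> 'cV[R]_m) (K : 'M[R]_(m, n)) v :
  (\forall x \near (0 : 'cV[R]_n), F x = K *m x) -> 'D_v F 0 = K *m v.
Proof. by move=> HF; rewrite (near_eq_derive _ HF) derive_mulmxl. Qed.

Lemma jac_near_linear n m (F : 'cV[R]_n -> 'cV[R]_m) (K : 'M[R]_(m, n)) :
  (\forall x \near (0 : 'cV[R]_n), F x = K *m x) -> jac F 0 = K.
Proof.
move=> HF; apply/matrixP => i j.
by rewrite mxE (derive_near_linear _ HF) -colE mxE.
Qed.

Lemma Ck_mulmxl n m k (K : 'M[R]_(m, n)) : Ck k (fun x : 'cV[R]_n => K *m x).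
Proof. by apply: Ck_linear_mx => c x y; rewrite mulmxDr scalemxAr. Qed.

Lemma Ck_col_mx (V : normedModType R) m1 m2 n k (A : V -> 'M[R]_(m1, n)) (B : V -> 'M[R]_(m2,
  n)) :
  Ck k A -> Ck k B -> Ck k (fun x => col_mx (A x) (B x)).
Proof.
move=> HA HB; apply: Ck_mx => i j; rewrite -(fintype.splitK i).
case: (fintype.split i) => l /=.
  by under eq_fun do rewrite col_mxEu; exact: Ck_coord.
by under eq_fun do rewrite col_mxEd; exact: Ck_coord.
Qed.

Lemma Ck_diff_delta n k (f : 'cV[R]_n -> R) (v : 'cV[R]_n) : Ck k.+1 f ->
  forall x, 'D_v f x = \sum_j v j 0 * 'D_(delta_mx j 0) f x.
Proof. by move=> [df _] x; rewrite deriveE // diff_delta_sum. Qed.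

(** Second derivatives in arbitrary directions are needed because the state
    splits in two blocks, while the Hessian matrix is given by the coordinates. *)
Lemma hessianE n (f : 'cV[R]_n -> R) (a v w : 'cV[R]_n) : Ck 2 f ->
  'D_v (fun b => 'D_w f b) a = (v^T *m hessian f a *m w) 0 0.
Proof.
move=> f2.
have Dj j : Ck 1 (fun b => 'D_(delta_mx j 0) f b) by exact: f2.2.
rewrite (@Ck_diff_delta _ 0 _ _ (f2.2 w)) mxE.
under [RHS]eq_bigr => j _ do rewrite mxE mulr_suml.
rewrite exchange_big /=; apply: eq_bigr => i _.
rewrite (_ : (fun b => 'D_w f b) = fun b => \sum_j w j 0 * 'D_(delta_mx j 0) f b); last first.
  by apply: funext => b; exact: (Ck_diff_delta _ f2).
have dd j : derivable (fun b => 'D_(delta_mx j 0) f b) a (delta_mx i 0).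
  by apply: diff_derivable; exact: (Dj j).1.
have -> : (fun b => \sum_j w j 0 * 'D_(delta_mx j 0) f b)
    = \sum_j (w j 0 *: (fun b => 'D_(delta_mx j 0) f b)).
  by apply: funext => b; rewrite fct_sumE.
rewrite derive_sum => [|j]; last exact: derivableZ.
rewrite mulr_sumr; apply: eq_bigr => j _; rewrite deriveZ // !mxE.
by rewrite mulrA mulrAC.
Qed.

End Coordinates.

(** * A flat function and a smooth step *)

Section FlatFunction.
Variable R : realType.

Lemma Ck_is_derive1 k (s s' : R -> R) :
  (forall x : R, is_derive x 1 s (s' x)) -> Ck k s' -> Ck k.+1 s.
Proof.
move=> ds Hs'.
have Ds x : differentiable s x by apply/derivable1_diffP.
split=> // v; apply: (@eq_Ck _ _ _ _ (fun x => s' x *: v)); last exact: Ck_scalel.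
move=> x; rewrite deriveE // -[in LHS](mulr1 v) -[v * 1]/(v *: 1) linearZ /=.
by rewrite -deriveE // derive_val; exact: mulrC.
Qed.

(** The functions t^(-m) exp(-1/t), extended by 0. The whole family is needed:
    derivatives of one member are combinations of the next ones. *)
Definition flat (m : nat) (x : R) : R :=
  if 0 < x then x ^- m * expR (- x^-1) else 0.

Lemma flat_gt0 m x : 0 < x -> 0 < flat m x.
Proof. by move=> x0; rewrite /flat x0 mulr_gt0 ?invr_gt0 ?exprn_gt0 ?expR_gt0. Qed.

Lemma flat_le0 m x : x <= 0 -> flat m x = 0.
Proof. by rewrite /flat leNgt => /negbTE ->. Qed.

Lemma flat_ge0 m x : 0 <= flat m x.
Proof. by have [/flat_le0 ->|/(flat_gt0 m)/ltW] := leP x 0. Qed.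

(** The exponential of 1/t exceeds the term of degree m + 2 of its series. The
    square makes the derivative at 0 exist and vanish. *)
Lemma flat_le_sqr m x : 0 < x -> flat m x <= (m.+2)`!%:R * x ^+ 2.
Proof.
move=> x0; rewrite /flat x0 expRN.
have xi0 : 0 <= x^-1 by rewrite invr_ge0 ltW.
have := expR_ge1Dxn m.+1 xi0; rewrite exprVn => E.
have {E} E : (x ^+ m.+2)^-1 / (m.+2)`!%:R <= expR x^-1 by apply: le_trans E; rewrite lerDr.
have p0 : 0 < (x ^+ m.+2)^-1 / (m.+2)`!%:R :> R.
  by rewrite divr_gt0 ?invr_gt0 ?exprn_gt0 // ltr0n fact_gt0.
rewrite (le_trans (y := x ^- m * ((x ^+ m.+2)^-1 / (m.+2)`!%:R)^-1)) //.
  by rewrite ler_pM2l ?invr_gt0 ?exprn_gt0 // lef_pV2 ?posrE ?expR_gt0.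
by rewrite invfM !invrK -addn2 exprD mulrA mulrA mulVf ?mul1r 1?mulrC // expf_neq0 // gt_eqF.
Qed.

Lemma is_derive_flat m (x : R) :
  is_derive x 1 (flat m) (flat m.+2 x - m%:R * flat m.+1 x).
Proof.
have [x0|x0|->] := ltgtP x 0.
- rewrite (flat_le0 m.+2 (ltW x0)) (flat_le0 m.+1 (ltW x0)) mulr0 subr0.
  apply: (@near_eq_is_derive _ _ _ (cst (0:R))).
  near=> y; rewrite flat_le0 //; apply: ltW; near: y; exact: lt_nbhsl.
- apply: (@near_eq_is_derive _ _ _ (fun y : R => (y^-1 ^+ m) * expR (- y^-1) : R)).
    near=> y; rewrite /flat ifT ?exprVn //; near: y; exact: lt_nbhsr.
  rewrite /flat x0.
  have dV : is_derive x 1 (fun y : R => y^-1) (- x ^- 2).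
    apply: is_derive_eq; first by apply: DeriveDef; [apply: derivableV => //; rewrite gt_eqF|].
    by rewrite deriveV ?gt_eqF // derive_id [LHS]mulr1.
  have dX := is_deriveX m dV; rewrite exprfctE in dX.
  have dE : is_derive x 1 (fun y : R => expR (- y^-1)) (expR (- x^-1) * x ^- 2).
    have dN : is_derive x 1 (fun y : R => - y^-1) (x ^- 2).
      by have := is_deriveN dV; rewrite opprK.
    exact: (@is_derive1_comp _ expR (fun y : R => - y^-1) x _ _ (is_derive_expR (- x^-1)) dN).
  have dM := is_deriveM dX dE.
  apply: (is_derive_eq dM) => /=.
  rewrite -!exprVn; set E := expR _; set y := x^-1.
  rewrite -[LHS]/(y ^+ m * (E * y ^+ 2) + E * ((m%:R * y ^+ m.-1) * - y ^+ 2)).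
  clearbody E y; case: {dX dM} m => [|k] /=.
    rewrite !mul0r !mulr0; ring.
  rewrite !exprS.
  ring.
- rewrite (flat_le0 m.+2) ?lexx // (flat_le0 m.+1) ?lexx // mulr0 subr0.
  have L : (fun h => h^-1 *: ((flat m \o shift 0) (h *: 1) - flat m 0)) @ 0^' --> (0 : R).
    apply/cvgrPdist_le => e e0; near=> h.
    rewrite /= addr0 [h *: 1]mulr1 (flat_le0 _ (lexx 0)) subr0 sub0r normrN normrM.
    have [h0|h0] := leP h 0; first by rewrite flat_le0 // normr0 mulr0 ltW.
    rewrite normfV (gtr0_norm h0) (gtr0_norm (flat_gt0 _ h0)).
    rewrite (le_trans (ler_wpM2l _ (flat_le_sqr _ h0))) ?invr_ge0 ?(ltW h0) //.
    rewrite mulrCA expr2 mulKf ?gt_eqF // mulrC -ler_pdivlMr ?ltr0n ?fact_gt0 //.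
    apply: le_trans (ler_norm _) _; near: h; apply: dnbhs0_le.
    by rewrite divr_gt0 // ltr0n fact_gt0.
  by apply: DeriveDef; [apply/cvg_ex; exists 0|exact: cvg_lim].
Unshelve. all: by end_near. Qed.

(** The induction on the order of differentiation runs over all m at once. *)
Lemma Ck_flat k m : Ck k (flat m).
Proof.
elim: k m => [|k IH] m; last first.
  apply: Ck_is_derive1 => [x|]; first exact: is_derive_flat.
  by apply: CkB => //; apply: CkM => //; exact: Ck_cst.
move=> x; apply: differentiable_continuous; apply/derivable1_diffP.
exact: (@ex_derive _ _ _ _ _ _ _ (is_derive_flat m x)).
Qed.

(** The two flat functions never vanish together, so the quotient is smooth. *)
Definition step (t : R) : R := flat 0 (2 - t) / (flat 0 (2 - t) + flat 0 (t - 1)).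

Lemma step_den_gt0 t : 0 < flat 0 (2 - t) + flat 0 (t - 1).
Proof.
have [t2|t2] := ltP t 2.
  by rewrite ltr_pwDl ?flat_ge0 // flat_gt0 // subr_gt0.
by rewrite ltr_wpDl ?flat_ge0 // flat_gt0 // subr_gt0; apply: lt_le_trans t2; rewrite ltr1n.
Qed.

Lemma step_ge0 t : 0 <= step t.
Proof. by rewrite divr_ge0 ?flat_ge0 // ltW // step_den_gt0. Qed.

Lemma step_eq1 t : t <= 1 -> step t = 1.
Proof.
move=> t1; have := step_den_gt0 t; rewrite /step [flat 0 (t - 1)]flat_le0 ?subr_le0 //.
by rewrite addr0 => h; rewrite divff // gt_eqF.
Qed.

Lemma step_eq0 t : 2 <= t -> step t = 0.
Proof. by move=> t2; rewrite /step flat_le0 ?subr_le0 // mul0r. Qed.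

Lemma Ck_step k : Ck k step.
Proof.
have idk : Ck k (fun t : R => t) by apply: (@Ck_linear _ _ _ _ idfun) => x.
have c2 : Ck k (fun t : R => flat 0 (2 - t)).
  by apply: (Ck_comp_real (Ck_flat _ _)); apply: CkB => //; exact: Ck_cst.
apply: CkM => //; apply: CkV => [x|]; first by rewrite gt_eqF // step_den_gt0.
apply: CkD => //; apply: (Ck_comp_real (Ck_flat _ _)); apply: CkB => //; exact: Ck_cst.
Qed.

End FlatFunction.

(** * Norms and compact sets of column vectors, bump functions, smooth selection *)

Section ColumnSpace.
Variable R : realType.

Lemma coord_le_norm m n (v : 'M[R]_(m, n)) i j : `|v i j| <= `|v|.
Proof. by rewrite [leRHS]/Num.Def.normr /= mx_normrE; exact: (le_bigmax _ _ (i, j)). Qed.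

Lemma mx_norm_lt m n (v : 'M[R]_(m, n)) (r : R) : 0 < r ->
  (forall i j, `|v i j| < r) -> `|v| < r.
Proof.
move=> r0 H; rewrite [ltLHS]/Num.Def.normr /= mx_normrE.
by apply/bigmax_ltP; split=> // -[i j] _; exact: H.
Qed.

Lemma mx_norm_tr m n (v : 'M[R]_(m, n)) : `|v^T| <= `|v|.
Proof.
rewrite [leLHS]/Num.Def.normr /= mx_normrE (bigmax_le _ (normr_ge0 v)) //= => -[i j] _.
by rewrite mxE; exact: coord_le_norm.
Qed.

Lemma mx_norm_mul m n p (A : 'M[R]_(m, n)) (B : 'M[R]_(n, p)) :
  `|A *m B| <= n%:R * (`|A| * `|B|).
Proof.
have r0 : 0 <= n%:R * (`|A| * `|B|) by rewrite !mulr_ge0.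
rewrite [leLHS]/Num.Def.normr /= mx_normrE (bigmax_le _ r0) //= => -[i j] _ /=.
rewrite mxE; apply: le_trans (ler_norm_sum _ _ _) _.
apply: (@le_trans _ _ (\sum_(k < n) `|A| * `|B|)); last first.
  by rewrite sumr_const card_ord mulr_natl.
by apply: ler_sum => k _; rewrite normrM ler_pM // coord_le_norm.
Qed.

Lemma near_norm_gt n (x : 'cV[R]_n) (M : R) : M < `|x| -> \forall y \near x, M < `|y|.
Proof.
move=> xM; apply/nbhs_normP; exists (`|x| - M) => [|y /=]; first by rewrite /= subr_gt0.
by have := lerB_dist x y; lra.
Qed.

(** Transposition carries the compactness of bounded closed sets of rows over to
    columns. *)
Lemma bounded_closed_compact_cV n (A : set 'cV[R]_n) (M : R) :
  (forall x, A x -> `|x| <= M) -> closed A -> compact A.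
Proof.
move=> AM Acl.
have tc p q : continuous (fun v : 'M[R]_(p, q) => v^T).
  by apply: linear_mx_continuous => c u v; rewrite linearP.
have -> : A = (fun v : 'rV[R]_n => v^T) @` [set v : 'rV[R]_n | A v^T].
  apply/seteqP; split=> [x Ax|x [v Av <-//]].
  by exists x^T; rewrite ?trmxK //= trmxK.
apply: continuous_compact; first exact/continuous_subspaceT/tc.
apply: bounded_closed_compact.
  exists M; split; first exact: num_real.
  move=> N MN v /AM vM; rewrite -(trmxK v); apply: le_trans (mx_norm_tr _) _.
  exact: le_trans vM (ltW MN).
by apply: closed_comp => // v _; exact: tc.
Qed.

(** Built on the Euclidean distance, which is smooth when squared, unlike the
    maximum norm of the space. *)
Definition bump n (c : 'cV[R]_n) (r : R) (x : 'cV[R]_n) : R :=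
  flat 0 (r ^+ 2 - \sum_i (x i 0 - c i 0) ^+ 2).

Lemma smooth_bump n c r : smooth (@bump n c r).
Proof.
move=> k; apply: (Ck_comp_real (Ck_flat _ _ _)); apply: CkB; first exact: Ck_cst.
apply: Ck_sum => i; apply: (@eq_Ck _ _ _ _ (fun x : 'cV[R]_n => (x i 0 - c i 0) * (x i 0 - c i 0))).
  by move=> x; rewrite expr2.
have H : Ck k (fun x : 'cV[R]_n => x i 0 - c i 0).
  apply: CkB; last exact: Ck_cst.
  by apply: Ck_linear_mx => s u v; rewrite !mxE.
exact: CkM.
Qed.

Lemma bump_ge0 n c r x : 0 <= @bump n c r x.
Proof. exact: flat_ge0. Qed.

Lemma bump_center n c r : 0 < r -> 0 < @bump n c r c.
Proof.
move=> r0; apply: flat_gt0; rewrite big1 ?subr0 ?exprn_gt0 // => i _.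
by rewrite subrr expr0n.
Qed.

(** A Euclidean ball lies in the ball of the maximum norm with the same radius. *)
Lemma bump_support n c r x : 0 < r -> @bump n c r x != 0 -> `|x - c| < r.
Proof.
move=> r0; apply: contraNlt => xr; apply/eqP/flat_le0; rewrite subr_le0 leNgt.
apply/negP => H; move: xr; rewrite leNgt => /negP; apply.
apply: mx_norm_lt => // i j; rewrite (ord1 j) !mxE.
rewrite -(@ltr_pXn2r _ 2) ?nnegrE ?normr_ge0 ?(ltW r0) // real_normK ?num_real //.
apply: le_lt_trans H; rewrite (bigD1 i) //= lerDl.
by apply: sumr_ge0 => k _; exact: sqr_ge0.
Qed.

End ColumnSpace.

Section SmoothSelection.
Variables (R : realType) (n m : nat).
Variables (a : 'cV[R]_n -> R) (b : 'cV[R]_n -> 'rV[R]_m).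
Hypotheses (ac : continuous a) (bc : continuous b).

(** Numerator T and denominator S of an input T / S which makes a + b u
    negative where S is positive, except at the origin. Multiplied by S the
    condition becomes that of a convex cone: pieces can be added without being
    normalized. *)
Definition piece (S : 'cV[R]_n -> R) (T : 'cV[R]_n -> 'cV[R]_m) : Prop :=
  [/\ smooth S, smooth T & forall x, [/\ 0 <= S x, S x = 0 -> T x = 0 &
    x != 0 -> 0 < S x -> a x * S x + (b x *m T x) 0 0 < 0]].

Lemma piece0 : piece (fun=> 0) (fun=> 0).
Proof.
by split=> [k|k|x]; [exact: Ck_cst|exact: Ck_cst|split=> //; rewrite ltxx].
Qed.

Lemma pieceD S1 T1 S2 T2 : piece S1 T1 -> piece S2 T2 ->
  piece (fun x => S1 x + S2 x) (fun x => T1 x + T2 x).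
Proof.
move=> [sS1 sT1 p1] [sS2 sT2 p2]; split=> [k|k|x]; try exact: CkD.
have [s1 z1 n1] := p1 x; have [s2 z2 n2] := p2 x; split.
- exact: addr_ge0.
- move/eqP; rewrite paddr_eq0 // => /andP[/eqP/z1 -> /eqP/z2 ->]; exact: addr0.
move=> x0; rewrite mulmxDr mxE mulrDr addrACA.
have [S10|S10] := eqVneq (S1 x) 0; have [S20|S20] := eqVneq (S2 x) 0.
- by rewrite S10 S20 addr0 ltxx.
- rewrite S10 (z1 S10) mulmx0 mxE mulr0 !add0r; exact: n2.
- rewrite S20 (z2 S20) mulmx0 [X in _ + (_ + X)]mxE mulr0 !addr0; exact: n1.
by move=> _; rewrite -[ltRHS]addr0 ltrD // ?n1 ?n2 // lt_def ?s1 ?s2 ?S10 ?S20.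
Qed.

Lemma piece_sum (I : Type) (s : seq I) S T : (forall i, piece (S i) (T i)) ->
  piece (fun x => \sum_(i <- s) S i x) (fun x => \sum_(i <- s) T i x).
Proof.
move=> H; elim: s => [|i s IH].
  under [X in piece X]eq_fun do rewrite big_nil.
  under [X in piece _ X]eq_fun do rewrite big_nil.
  exact: piece0.
under [X in piece X]eq_fun do rewrite big_cons.
under [X in piece _ X]eq_fun do rewrite big_cons.
exact: pieceD.
Qed.

(** An inequality satisfied at c by a constant input persists around c. *)
Lemma piece_bump (c : 'cV[R]_n) (u : 'cV[R]_m) (D : R) : 0 < D ->
  a c + (b c *m u) 0 0 < 0 ->
  exists S T, [/\ piece S T, 0 < S c & forall x, S x != 0 -> `|x - c| < D].
Proof.
move=> D0 cu.
have [d /= d0 Hd] : exists2 d, 0 < d & forall x, `|x - c| < d -> a x + (b x *m u) 0 0 < 0.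
  have gc : continuous (fun x => a x + (b x *m u) 0 0).
    apply: (@CkD _ _ _ 0 a) => //; apply: (@Ck_coord _ _ _ _ 0).
    by apply: (@Ck_mulmx _ _ _ _ _ 0) => //; exact: (@Ck_cst _ _ _ 0).
  have /nbhs_normP[d d0 Hd] : \forall x \near c, a x + (b x *m u) 0 0 < 0.
    exact: (cvgr_lt _ (gc c) 0 cu).
  by exists d => // x xd; apply: Hd; rewrite /= distrC.
pose r := Num.min d D.
have r0 : 0 < r by rewrite lt_min d0.
exists (bump c r), (fun x => bump c r x *: u); split; last 2 first.
- exact: bump_center.
- by move=> x /(bump_support r0); rewrite lt_min => /andP[].
split=> [||x]; first exact: smooth_bump.
  by move=> k; apply: Ck_scalel; exact: smooth_bump.
split; first exact: bump_ge0.
  by move=> ->; rewrite scale0r.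
move=> _ bx; rewrite -scalemxAr mxE mulrC -mulrDr pmulr_rlt0 //.
by apply: Hd; move: bx; rewrite lt_neqAle eq_sym => /andP[/(bump_support r0) + _];
  rewrite lt_min => /andP[].
Qed.

(** Finitely many bumps cover a compact set, and pieces add up. *)
Lemma piece_cover (A : set 'cV[R]_n) (D : R) : 0 < D -> compact A ->
  (forall c, A c -> exists u : 'cV[R]_m, a c + (b c *m u) 0 0 < 0) ->
  exists S T, [/\ piece S T, forall x, A x -> 0 < S x &
    forall x, S x != 0 -> exists2 c, A c & `|x - c| < D].
Proof.
move=> D0 cA HA.
have /choice[ST HST] : forall c, exists ST : ('cV[R]_n -> R) * ('cV[R]_n -> 'cV[R]_m),
    piece ST.1 ST.2 /\ (A c -> 0 < ST.1 c /\ forall x, ST.1 x != 0 -> `|x - c| < D).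
  move=> c; have [Ac|nAc] := pselect (A c).
    have [u cu] := HA c Ac; have [S [T [pST Sc Ssup]]] := piece_bump D0 cu.
    by exists (S, T).
  by exists (fun=> 0, fun=> 0); split=> //; exact: piece0.
have := cA; rewrite compact_cover => /(_ _ A (fun c => [set x | 0 < (ST c).1 x])).
case.
- move=> c Ac; have [[Sc _ _] _] := HST c.
  apply: (@open_comp _ _ (ST c).1 [set t | 0 < t]); last exact: open_gt.
  by move=> x _; exact: (Sc 0).
- by move=> x Ax; exists x => //; have [_ /(_ Ax)[]] := HST x.
move=> F FA AF; exists (fun x => \sum_(c <- finmap.enum_fset F) (ST c).1 x),
  (fun x => \sum_(c <- finmap.enum_fset F) (ST c).2 x).
have ge0 c x : 0 <= (ST c).1 x by have [[_ _ /(_ x)[]]] := HST c.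
split.
- by apply: piece_sum => c; have [] := HST c.
- move=> x /AF[c /= cF Scx]; rewrite lt_neqAle sumr_ge0 // andbT eq_sym.
  rewrite psumr_eq0 //; apply/negP => /allP/(_ c cF) /=.
  by rewrite gt_eqF.
- move=> x; rewrite psumr_eq0 // => /allPn[c cF /= Scx]; exists c.
    by have := FA _ cF; rewrite inE.
  have Ac : A c by have := FA _ cF; rewrite inE.
  by have [_ /(_ Ac)[_ H]] := HST c; exact: H.
Qed.


(** An affine function of u is bounded below only if its slope vanishes. *)
Lemma exists_decreasing_input c : (b c = 0 -> a c < 0) ->
  exists u : 'cV[R]_m, a c + (b c *m u) 0 0 < 0.
Proof.
move=> Hc; have [bc0|bc0] := eqVneq (b c) 0.
  by exists 0; rewrite mulmx0 mxE addr0 Hc.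
have [i bi] : exists i, b c 0 i != 0.
  apply: contrapT => /forallNP H; move/eqP: bc0; apply; apply/rowP => i.
  by rewrite mxE; apply/eqP/negP => /negP /H.
exists (- ((a c + 1) / b c 0 i) *: delta_mx i 0).
rewrite -scalemxAr mxE -colE mxE mulNr divfK //.
by rewrite opprD addNKr oppr_lt0 ltr01.
Qed.

(** The inequality is convex in u, so local solutions can be patched: a bump
    around the origin carries the linear input, and compact shells that exhaust
    the rest of the space carry finitely many constant inputs each. The sum of
    all pieces is locally finite, its denominator is positive everywhere, and
    near the origin only the linear piece is active. *)
Theorem smooth_selection (K : 'M[R]_(m, n)) (r : R) : 0 < r ->
  (forall x, x != 0 -> `|x| < r -> a x + (b x *m (K *m x)) 0 0 < 0) ->
  (forall x, x != 0 -> b x = 0 -> a x < 0) ->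
  exists alpha : 'cV[R]_n -> 'cV[R]_m,
    [/\ smooth alpha, \forall x \near (0 : 'cV[R]_n), alpha x = K *m x &
      forall x, x != 0 -> a x + (b x *m alpha x) 0 0 < 0].
Proof.
move=> r0 HK Hab.
pose S0 := bump (0 : 'cV[R]_n) r; pose T0 x := S0 x *: (K *m x).
have S0_ge0 x : 0 <= S0 x by exact: bump_ge0.
have p0 : piece S0 T0.
  split=> [||x]; first exact: smooth_bump.
    move=> k; apply: CkZ; first exact: smooth_bump.
    by apply: Ck_linear_mx => s u v; rewrite mulmxDr scalemxAr.
  split=> //; first by rewrite /T0 => ->; rewrite scale0r.
  move=> x0 Sx; rewrite -scalemxAr mxE mulrC -mulrDr pmulr_rlt0 //; apply: HK => //.
  by rewrite -[x]subr0; apply: bump_support => //; rewrite gt_eqF.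
have S0c : continuous S0 by exact: (@smooth_bump _ _ _ _ 0).
have [d /= d0 Hd] : exists2 d : R, 0 < d & forall x, `|x| < d -> 0 < S0 x.
  have /nbhs_normP[d d0 Hd] : \forall x \near (0 : 'cV[R]_n), 0 < S0 x.
    exact: (cvgr_gt _ (S0c 0) 0 (bump_center _ r0)).
  by exists d => // x xd; apply: Hd; rewrite /= sub0r normrN.
(* A radius at most 1 keeps the family locally finite; a radius at most d / 2
   keeps it off the ball of radius d / 2 around 0. *)
pose D := Num.min 1 (d / 2).
have D0 : 0 < D by rewrite lt_min ltr01 divr_gt0.
(* The shells avoid a neighbourhood of 0, where only the linear input is to
   be active. *)
pose A (N : nat) : set 'cV[R]_n := [set x | [/\ N%:R <= `|x|, `|x| <= N.+1%:R & S0 x = 0]].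
have cA N : compact (A N).
  apply: (@bounded_closed_compact_cV _ _ _ N.+1%:R) => [x []//|].
  have nc : continuous (fun x : 'cV[R]_n => `|x|) by exact: norm_continuous.
  rewrite (_ : A N = [set x | N%:R <= `|x|] `&` ([set x | `|x| <= N.+1%:R] `&` [set x | S0 x =
    0])).
    apply: closedI; [|apply: closedI].
    - by apply: (@closed_comp _ _ (fun x : 'cV[R]_n => `|x|) [set t | N%:R <= t]);
        [move=> x _; exact: nc|exact: closed_ge].
    - by apply: (@closed_comp _ _ (fun x : 'cV[R]_n => `|x|) [set t | t <= N.+1%:R]);
        [move=> x _; exact: nc|exact: closed_le].
    by apply: (@closed_comp _ _ S0 [set t | t = 0]);
        [move=> x _; exact: S0c|exact: closed_eq].
  by apply/seteqP; split=> x /=; [case|case=> ? []].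
have A_neq0 N x : A N x -> d <= `|x|.
  by move=> [_ _ Sx]; rewrite leNgt; apply/negP => /Hd; rewrite Sx ltxx.
have /choice[ST HST] : forall N, exists ST : ('cV[R]_n -> R) * ('cV[R]_n -> 'cV[R]_m),
    [/\ piece ST.1 ST.2, forall x, A N x -> 0 < ST.1 x &
      forall x, ST.1 x != 0 -> exists2 c, A N c & `|x - c| < D].
  move=> N; have [|S [T HST]] := piece_cover D0 (cA N); last by exists (S, T).
  move=> c Ac; apply: exists_decreasing_input; apply: Hab.
  by rewrite -normr_gt0; apply: lt_le_trans (A_neq0 _ _ Ac).
pose S N := (ST N).1; pose T N := (ST N).2.
have pN N : piece (S N) (T N) by have [] := HST N.
have S_ge0 N x : 0 <= S N x by have [_ _ /(_ x)[]] := pN N.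
have S_far N x : `|x| + 1 <= N%:R -> S N x = 0.
  move=> xN; apply/eqP/negPn/negP => Sx; have [_ _ /(_ x Sx)[c [Nc _ _] xc]] := HST N.
  move: xc; rewrite lt_min => /andP[xc _];
  have : `|c| <= `|c - x| + `|x| by rewrite -{1}(subrK x c); exact: ler_normD.
  rewrite distrC; lra.
have S_near N x : `|x| < d / 2 -> S N x = 0.
  move=> xN; apply/eqP/negPn/negP => Sx; have [_ _ /(_ x Sx)[c Ac xc]] := HST N.
  move: xc; rewrite lt_min => /andP[_ xc]; have := A_neq0 _ _ Ac.
  have : `|c| <= `|c - x| + `|x| by rewrite -{1}(subrK x c); exact: ler_normD.
  rewrite distrC; lra.
have T_0 N x : S N x = 0 -> T N x = 0 by have [_ _ /(_ x)[]] := pN N.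
pose SM M x := S0 x + \sum_(N < M) S N x; pose TM M x := T0 x + \sum_(N < M) T N x.
have pM M : piece (SM M) (TM M) by apply: pieceD => //; exact: piece_sum.
pose bd (x : 'cV[R]_n) := Num.bound (`|x| + 1).
have bdP x : `|x| + 1 < (bd x)%:R by apply: archi_boundP; rewrite addr_ge0.
have stab M x : `|x| + 1 <= M%:R -> SM M x = SM (bd x) x /\ TM M x = TM (bd x) x.
  suff H k l : `|x| + 1 <= k%:R -> (k <= l)%N -> SM l x = SM k x /\ TM l x = TM k x.
    move=> xM; have [ML|/ltnW ML] := leqP M (bd x).
      by have [-> ->] := H _ _ xM ML.
    by have [-> ->] := H _ _ (ltW (bdP x)) ML.
  move=> xk /subnK <-; elim: (l - k)%N => // j [IH1 IH2].
  have Sj : S (j + k)%N x = 0.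
    by apply: S_far; apply: le_trans xk _; rewrite ler_nat leq_addl.
  rewrite /SM /TM addSn !big_ord_recr /= Sj T_0 // !addr0; split; [exact: IH1|exact: IH2].
pose Sx x := SM (bd x) x; pose Tx x := TM (bd x) x.
have Sx_gt0 x : 0 < Sx x.
  rewrite /Sx /SM; have [Sx0|Sx0] := eqVneq (S0 x) 0; last first.
    by rewrite ltr_pwDl ?sumr_ge0 // lt_neqAle eq_sym Sx0 S0_ge0.
  have Nx : (Num.truncn `|x| < bd x)%N.
    rewrite -(ltr_nat R); apply: le_lt_trans (bdP x).
    by apply: le_trans (_ : `|x| <= _); rewrite ?truncn_le ?lerDl.
  rewrite Sx0 add0r (bigD1 (Ordinal Nx)) //= ltr_pwDl ?sumr_ge0 //.
  have [_ H _] := HST (Num.truncn `|x|); apply: H; split=> //.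
    by rewrite truncn_le.
  by apply/ltW; exact: truncnS_gt.
have loc (x : 'cV[R]_n) : exists2 M, piece (SM M) (TM M) &
    \forall y \near x, Sx y = SM M y /\ Tx y = TM M y.
  exists (Num.bound (`|x| + 2)) => //.
  apply/nbhs_normP; exists 1 => //= y xy.
  have [] := stab (Num.bound (`|x| + 2)) y; last by move=> -> ->.
  have : `|y| <= `|x| + `|x - y|.
    by rewrite -[in leLHS](subrKC x y) (le_trans (ler_normD _ _)) // lerD2l distrC.
  move: xy; rewrite /= => xy yx; apply: (@le_trans _ _ (`|x| + 2)); first lra.
  by apply/ltW/archi_boundP; rewrite addr_ge0.
exists (fun x => (Sx x)^-1 *: Tx x); split.
- move=> k; apply: CkZ.
    apply: CkV => [x|]; first by rewrite gt_eqF.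
    apply: Ck_local => x; have [M [sM _ _] HM] := loc x; exists (SM M) => //.
    by apply: filterS HM => y [].
  apply: Ck_local => x; have [M [_ tM _] HM] := loc x; exists (TM M) => //.
  by apply: filterS HM => y [].
- apply/nbhs_normP; exists (d / 2) => /=; first by rewrite divr_gt0.
  move=> x /=; rewrite sub0r normrN => xd.
  have ES : Sx x = S0 x by rewrite /Sx /SM big1 ?addr0 // => i _; exact: S_near.
  have ET : Tx x = T0 x.
    by rewrite /Tx /TM big1 ?addr0 // => i _; apply/T_0/S_near.
  by rewrite ET /T0 -ES scalerA mulVf ?scale1r // gt_eqF.
move=> x x0; have [_ _ /(_ x)[_ _ /(_ x0 (Sx_gt0 x))]] := pM (bd x).
rewrite -/(Sx x) -/(Tx x) => H.
rewrite -scalemxAr mxE -[X in X + _](mulKf (lt0r_neq0 (Sx_gt0 x))) -mulrDr.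
by rewrite pmulr_rlt0 ?invr_gt0 // [Sx x * _]mulrC.
Qed.

End SmoothSelection.

(** * Global solutions of Lipschitz differential equations *)

Section GlobalFlow.
Variable R : realType.

Lemma nondecreasing_of_derive (h h' : R -> R) (t : R) : 0 <= t ->
  (forall s : R, 0 <= s -> is_derive s 1 h (h' s)) -> (forall s : R, 0 <= s -> 0 <= h' s) ->
  h 0 <= h t.
Proof.
move=> t0 dh h'0.
have [x||c /[!in_itv]/= /andP[c0 _] E] := @MVT_segment _ h h' 0 t t0.
- by rewrite in_itv /= => /andP[/ltW x0 _]; exact: dh.
- apply: derivable_within_continuous => s; rewrite in_itv /= => /andP[s0 _].
  exact: (@ex_derive _ _ _ _ _ _ _ (dh s s0)).
by rewrite -subr_ge0 E mulr_ge0 ?h'0 ?subr0.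
Qed.

(** Replaces the estimate of the norm of an integral by the integral of a bound
    of the norm. *)
Lemma norm_primitive_le n (C c : R -> 'cV[R]_n) (g g' : R -> R) (t : R) : 0 <= t ->
  (forall s : R, 0 <= s -> is_derive s 1 C (c s)) ->
  (forall s : R, 0 <= s -> is_derive s 1 g (g' s)) ->
  (forall s : R, 0 <= s -> `|c s| <= g' s) ->
  `|C t - C 0| <= g t - g 0.
Proof.
move=> t0 dC dg cg.
have dCi i (s : R) : 0 <= s -> is_derive s 1 (fun s => C s i 0) (c s i 0).
  move=> /dC dCs; have dd := @ex_derive _ _ _ _ _ _ _ dCs.
  apply: DeriveDef; first exact: (derivable_mxP _ _ _).1 dd i 0.
  by have := @derive_val _ _ _ _ _ _ _ dCs; rewrite derive_mx // => <-; rewrite mxE.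
have cgi i (s : R) : 0 <= s -> `|c s i 0| <= g' s.
  by move=> s0; apply: le_trans (cg s s0); exact: coord_le_norm.
have g0 : 0 <= g t - g 0.
  rewrite subr_ge0; apply: (nondecreasing_of_derive t0 dg) => s s0.
  exact: le_trans (normr_ge0 _) (cg s s0).
rewrite [leLHS]/Num.Def.normr /= mx_normrE (bigmax_le _ g0) //= => -[i j] _.
rewrite (ord1 j) !mxE /= ler_norml; apply/andP; split.
  have := @nondecreasing_of_derive (g + (fun s => C s i 0)) _ t t0
    (fun s s0 => is_deriveD (dg s s0) (dCi i s s0)).
  rewrite /= !fctE => H; have {}H : g 0 + C 0 i 0 <= g t + C t i 0.
    by apply: H => s /(cgi i); rewrite ler_norml => /andP[]; lra.
  by move: H; lra.
have := @nondecreasing_of_derive (g - (fun s => C s i 0)) _ t t0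
    (fun s s0 => is_deriveB (dg s s0) (dCi i s s0)).
rewrite /= !fctE => H; have {}H : g 0 - C 0 i 0 <= g t - C t i 0.
  by apply: H => s /(cgi i); rewrite ler_norml => /andP[]; lra.
by move: H; lra.
Qed.

Lemma exists_primitive_real (c : R -> R) : (forall t : R, 0 <= t -> {for t, continuous c}) ->
  exists2 C : R -> R, C 0 = 0 & forall t : R, 0 <= t -> is_derive t 1 C (c t).
Proof.
move=> cc; pose k t := c (Num.max t 0).
have kc : continuous k.
  move=> t.
  have mc : {for t, continuous (fun t : R => Num.max t 0)}.
    by apply: (@continuous_max _ _ (fun t => t) (fun=> 0)); [exact: cvg_id|exact: cvg_cst].
  apply: (continuous_comp mc); apply: cc; by rewrite le_max lexx orbT.
(* Integrating from -1 makes G differentiable at 0. *)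
pose G t := (\int[lebesgue_measure]_(s in `[(-1)%R, t]) (k s))%R.
have dG (t : R) : 0 <= t -> is_derive t 1 G (c t).
  move=> t0; have [| |||dd dE] := @continuous_FTC1_closed _ k (-1) t (t + 1).
  - by rewrite ltrDl.
  - apply: continuous_compact_integrable; first exact: segment_compact.
    exact: continuous_subspaceT.
  - by apply: lt_le_trans t0; rewrite oppr_lt0.
  - exact: kc.
  apply: DeriveDef => //; rewrite -derive1E dE /k max_l //.
exists (fun t => G t - G 0); first by rewrite subrr.
move=> t t0; have := is_deriveB (dG t t0) (@is_derive_cst _ _ _ (G 0) t 1).
by rewrite subr0.
Qed.

Lemma exists_primitive n (c : R -> 'cV[R]_n) : (forall t : R, 0 <= t -> {for t, continuous c}) ->
  exists2 C : R -> 'cV[R]_n, C 0 = 0 & forall t : R, 0 <= t -> is_derive t 1 C (c t).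
Proof.
move=> cc.
have /choice[C HC] : forall i, exists Ci : R -> R,
    Ci 0 = 0 /\ forall t : R, 0 <= t -> is_derive t 1 Ci (c t i 0).
  move=> i; have [|C C0 dC] := @exists_primitive_real (fun t => c t i 0); last by exists C.
  move=> t /cc ct; apply: (@continuous_comp _ _ _ c (fun M : 'cV[R]_n => M i 0)) => //.
  exact: coord_continuous.
exists (fun t => \col_i C i t); first by apply/matrixP => i j; rewrite !mxE (HC i).1.
move=> t t0; have dd : derivable (fun t => \col_i C i t) t 1.
  apply/derivable_mxP => i j; under eq_fun do rewrite mxE.
  exact: (@ex_derive _ _ _ _ _ _ _ ((HC i).2 t t0)).
apply: DeriveDef => //; rewrite derive_mx //; apply/matrixP => i j; rewrite mxE (ord1 j).
under eq_fun do rewrite mxE.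
exact: (@derive_val _ _ _ _ _ _ _ ((HC i).2 t t0)).
Qed.

(** In each coordinate the sequence lies between a nondecreasing and a
    nonincreasing one, u k - 2 b 2^-k and u k + 2 b 2^-k; the supremum of the
    first separates them. *)
Lemma geometric_limit n (u : nat -> 'cV[R]_n) (b : R) :
  (forall k, `|u k.+1 - u k| <= b * 2 ^- k) ->
  exists l, forall k, `|u k - l| <= 2 * b * 2 ^- k.
Proof.
move=> Hu.
have b0 : 0 <= b by have := Hu 0; rewrite expr0 invr1 mulr1; exact: le_trans.
suff /choice[l Hl] : forall i, exists l : R, forall k, `|u k i 0 - l| <= 2 * b * 2 ^- k.
  exists (\col_i l i) => k; rewrite [leLHS]/Num.Def.normr /= mx_normrE.
  apply: bigmax_le => [|[i j] _]; first by rewrite !mulr_ge0 ?invr_ge0 ?exprn_ge0.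
  by rewrite (ord1 j) !mxE; exact: Hl.
move=> i; pose w k := u k i 0 - 2 * b * 2 ^- k; pose v k := u k i 0 + 2 * b * 2 ^- k.
have step k : `|u k.+1 i 0 - u k i 0| <= b * 2 ^- k.
  by apply: le_trans (Hu k); have := coord_le_norm (u k.+1 - u k) i 0; rewrite !mxE.
have half k : (2 ^- k.+1 : R) = 2 ^- k / 2 by rewrite exprS invfM mulrC.
have wS k : w k <= w k.+1.
  by have := step k; rewrite /w half ler_norml => /andP[]; lra.
have vS k : v k.+1 <= v k.
  by have := step k; rewrite /v half ler_norml => /andP[]; lra.
have wM k l : (k <= l)%N -> w k <= w l.
  by move=> /subnK <-; elim: (l - k)%N => // j IH; apply: le_trans IH _; rewrite addSn.
have vM k l : (k <= l)%N -> v l <= v k.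
  by move=> /subnK <-; elim: (l - k)%N => // j IH; apply: le_trans _ IH; rewrite addSn.
have wv k l : w k <= v l.
  apply: (@le_trans _ _ (w (maxn k l))); first by apply: wM; exact: leq_maxl.
  apply: (@le_trans _ _ (v (maxn k l))); last by apply: vM; exact: leq_maxr.
  have : 0 <= 2 * b * 2 ^- maxn k l by rewrite !mulr_ge0 ?invr_ge0 ?exprn_ge0.
  by rewrite /w /v; lra.
exists (sup (range w)) => k.
have wsup : w k <= sup (range w).
  by apply: sup_upper_bound; [split;
    [by exists (w 0%N), 0%N|by exists (v 0%N) => _ [j _ <-]]|exists k].
have supv : sup (range w) <= v k.
  by apply: ge_sup; [by exists (w 0%N), 0%N|move=> _ [j _ <-]].
by move: wsup supv; rewrite /w /v ler_norml => ? ?; apply/andP; split; lra.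
Qed.


End GlobalFlow.

Section Picard.
Variable R : realType.
Lemma lipschitz_continuous (V W : normedModType R) (F : V -> W) (L : R) : 0 < L ->
  (forall u v, `|F u - F v| <= L * `|u - v|) -> continuous F.
Proof.
move=> L0 HF x; apply/cvgrPdist_le => e e0; apply/nbhs_normP.
exists (e / L) => [|y /= xy]; first by rewrite /= divr_gt0.
by apply: le_trans (HF _ _) _; rewrite mulrC -ler_pdivlMr // ltW.
Qed.

Lemma pow2_large (b : R) : exists k, b < 2 ^+ k.
Proof.
exists (Num.bound `|b|); apply: (le_lt_trans (ler_norm b)).
apply: lt_trans (archi_boundP (normr_ge0 b)) _.
by rewrite -natrX ltr_nat ltn_expl.
Qed.

(** Picard iteration. Measured against the weight exp(2 L t), the increments are
    halved at each step, so that the iterates converge on the whole half-line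
    at once and no continuation of local solutions is required. *)
Theorem picard_global n (F : 'cV[R]_n -> 'cV[R]_n) (L : R) (x0 : 'cV[R]_n) : 0 < L ->
  (forall u v, `|F u - F v| <= L * `|u - v|) ->
  exists2 Y : R -> 'cV[R]_n, Y 0 = x0 & forall t : R, 0 <= t -> is_derive t 1 Y (F (Y t)).
Proof.
move=> L0 HF.
have Fc := lipschitz_continuous L0 HF.
have /choice[P HP] : forall c : R -> 'cV[R]_n, exists C : R -> 'cV[R]_n,
    (forall t : R, 0 <= t -> {for t, continuous c}) ->
    C 0 = 0 /\ forall t : R, 0 <= t -> is_derive t 1 C (c t).
  move=> c; have [/exists_primitive[C C0 dC]|nc] := pselect (forall t : R, 0 <= t -> {for t,
    continuous c}).
    by exists C.
  by exists 0.
pose next (x : R -> 'cV[R]_n) t := x0 + P (F \o x) t.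
pose x k := iter k next (fun=> x0).
have next0 y : (forall t : R, 0 <= t -> {for t, continuous y}) -> next y 0 = x0.
  move=> yc; have [] := HP (F \o y); last by move=> E _; rewrite /next E addr0.
  by move=> t /yc yt; exact: (continuous_comp yt (Fc _)).
have dnext y : (forall t : R, 0 <= t -> {for t, continuous y}) ->
    forall t : R, 0 <= t -> is_derive t 1 (next y) (F (y t)).
  move=> yc t t0; have [|_ /(_ t t0) dP] := HP (F \o y).
    by move=> s /yc ys; exact: (continuous_comp ys (Fc _)).
  have := is_deriveD (@is_derive_cst _ _ _ x0 t 1) dP.
  by rewrite add0r.
have xc k (t : R) : 0 <= t -> {for t, continuous (x k)}.
  elim: k t => [|k IH] t t0; first exact: cst_continuous.
  apply: differentiable_continuous; apply/derivable1_diffP.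
  exact: (@ex_derive _ _ _ _ _ _ _ (dnext _ IH t t0)).
have dx k (t : R) : 0 <= t -> is_derive t 1 (x k.+1) (F (x k t)).
  by apply: dnext; exact: xc.
have x_0 k : x k 0 = x0 by case: k => // k; exact/next0/xc.
pose E (t : R) := expR (2 * L * t).
have dE (b t : R) : is_derive t 1 (fun t => b * E t) (2 * L * b * E t).
  have d1 : is_derive t 1 (fun t : R => 2 * L * t) (2 * L).
    by have := is_deriveZ (2 * L) (is_derive_id t 1); rewrite [_ *: 1]mulr1.
  have d2 := @is_derive1_comp _ expR (fun t : R => 2 * L * t) t _ _ (is_derive_expR (2 * L * t)) d1.
  have := is_deriveZ b d2; set d := _ *: _ => H; apply: (is_derive_eq H).
  by rewrite /d -[_ *: _]/(b * (E t * (2 * L))); ring.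
have E1 (t : R) : 0 <= t -> 1 <= E t.
  by move=> t0; rewrite -expR0 ler_expR mulr_ge0 // mulr_ge0 // ltW.
have E_le (s t : R) : s <= t -> E s <= E t.
  by move=> st; rewrite ler_expR ler_wpM2l // mulr_ge0 // ltW.
have half k : (2 ^- k.+1 : R) = 2 ^- k / 2 by rewrite exprS invfM mulrC.
have p2 k : 0 < (2 ^- k : R) by rewrite invr_gt0 exprn_gt0.
(* The rate 2 * L of E is twice the Lipschitz constant: integrating a bound
   L * b' * E gives b' / 2 * E. *)
have cmp (C1 C2 c1 c2 : R -> 'cV[R]_n) (b t : R) : 0 <= b -> 0 <= t -> C1 0 = C2 0 ->
    (forall s : R, 0 <= s -> is_derive s 1 C1 (c1 s)) ->
    (forall s : R, 0 <= s -> is_derive s 1 C2 (c2 s)) ->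
    (forall s : R, 0 <= s -> `|c1 s - c2 s| <= 2 * L * b * E s) ->
    `|C1 t - C2 t| <= b * E t.
  move=> b0 t0 C12 d1 d2 H.
  have := @norm_primitive_le R n (C1 - C2) _ _ _ t t0
    (fun s s0 => is_deriveB (d1 s s0) (d2 s s0)) (fun s _ => dE b s) H.
  rewrite !fctE C12 subrr subr0 => /le_trans; apply.
  by rewrite gerBl mulr_ge0 // expR_ge0.
(* The constant that bounds the first increment. *)
pose B := `|F x0| / (2 * L).
have B0 : 0 <= B by rewrite divr_ge0 // mulr_ge0 // ltW.
have xS k (t : R) : 0 <= t -> `|x k.+1 t - x k t| <= B * E t * 2 ^- k.
  rewrite mulrAC; elim: k t => [|k IH] t t0.
    have B2 : 0 <= B * 2 ^- 0 by rewrite expr0 invr1 mulr1.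
    apply: (cmp _ _ (fun s => F (x 0%N s)) (fun=> 0) _ _ B2 t0) => //.
    move=> s s0; rewrite subr0 expr0 invr1 mulr1.
    have -> : 2 * L * B = `|F x0| by rewrite /B mulrC divfK // mulf_neq0 // gt_eqF.
    by rewrite ler_peMr // E1.
  have B2 : 0 <= B * 2 ^- k.+1 by rewrite mulr_ge0 // ltW.
  apply: (cmp _ _ (fun s => F (x k.+1 s)) (fun s => F (x k s)) _ _ B2 t0) => //.
    by rewrite !x_0.
  move=> s s0; apply: le_trans (HF _ _) _; rewrite half.
  by have := IH s s0; rewrite -(ler_pM2l L0) => /le_trans; apply; rewrite le_eqVlt; apply/orP;
    left; apply/eqP; field.
have /choice[y Hy] : forall t : R, exists l : 'cV[R]_n, 0 <= t ->
    forall k, `|x k t - l| <= 2 * (B * E t) * 2 ^- k.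
  move=> t; have [t0|t0] := leP 0 t; last by exists 0.
  by have [l Hl] := geometric_limit (fun k => xS k t t0); exists l.
(* Nothing is known of y at negative times, while primitives are taken of
   functions continuous at 0 on both sides. *)
pose z t := y (Num.max t 0).
have zy (t : R) : 0 <= t -> z t = y t by move=> t0; rewrite /z max_l.
have small (b e : R) : 0 < e -> exists k, b * 2 ^- k < e.
  move=> e0; have [k Hk] := pow2_large (b / e); exists k; move: Hk.
  by rewrite !ltr_pdivrMr ?exprn_gt0 // mulrC.
have zc (t : R) : 0 <= t -> {for t, continuous z}.
  move=> t0; apply/cvgrPdist_le => e e0.
  have [k Hk] := small (8 * (B * E (t + 1))) _ e0.
  have xk : \forall s \near t, `|x k (Num.max t 0) - x k (Num.max s 0)| <= e / 4.
    have mc : {for t, continuous (fun t : R => Num.max t 0)}.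
      by apply: (@continuous_max _ _ (fun t => t) (fun=> 0)); [exact: cvg_id|exact: cvg_cst].
    have xm : {for Num.max t 0, continuous (x k)} by apply: xc; rewrite le_max lexx orbT.
    have /cvgrPdist_le := continuous_comp mc xm.
    by apply; rewrite divr_gt0.
  near=> s.
  have s0 : 0 <= Num.max s 0 by rewrite le_max lexx orbT.
  have mt0 : 0 <= Num.max t 0 by rewrite le_max lexx orbT.
  have st : Num.max s 0 <= t + 1.
    by rewrite ge_max; apply/andP; split; [apply/ltW; near: s; apply: lt_nbhsl;
      rewrite ltrDl|rewrite addr_ge0].
  have mtt : Num.max t 0 <= t + 1 by rewrite max_l // lerDl.
  have h1 := Hy _ s0 k; have h2 := Hy _ mt0 k; rewrite -/(z s) -/(z t) in h1 h2.
  have h3 : `|x k (Num.max t 0) - x k (Num.max s 0)| <= e / 4 by near: s.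
  have h4 : B * E (Num.max s 0) * 2 ^- k <= B * E (t + 1) * 2 ^- k.
    by rewrite ler_pM2r // ler_wpM2l // E_le.
  have h5 : B * E (Num.max t 0) * 2 ^- k <= B * E (t + 1) * 2 ^- k.
    by rewrite ler_pM2r // ler_wpM2l // E_le.
  have -> : z t - z s = (z t - x k (Num.max t 0)) + ((x k (Num.max t 0) - x k (Num.max s 0)) +
    (x k (Num.max s 0) - z s)).
    by rewrite !subrKA.
  apply: le_trans (ler_normD _ _) _; rewrite [X in X + _]distrC.
  have := ler_normD (x k (Num.max t 0) - x k (Num.max s 0)) (x k (Num.max s 0) - z s).
  by move: h1 h2 h3 h4 h5 Hk; lra.
(* The limit y of the iterates is not known to be differentiable; one more
   Picard step Y is, and the estimates identify it with y. *)
pose Y := next z.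
have dY (t : R) : 0 <= t -> is_derive t 1 Y (F (z t)) by exact: dnext.
have Yy (t : R) : 0 <= t -> Y t = z t.
  move=> t0; apply/eqP; rewrite -subr_eq0 -normr_le0 leNgt;
    apply/negP => /(small (3 * B * E t))[k].
  apply/negP; rewrite -leNgt.
  have h1 : `|x k.+1 t - Y t| <= B * 2 ^- k * E t.
    have B2 : 0 <= B * 2 ^- k by rewrite mulr_ge0 // ltW.
    apply: (cmp _ _ (fun s => F (x k s)) (fun s => F (z s)) _ _ B2 t0) => //.
      by rewrite x_0 /Y next0.
    move=> s s0; apply: le_trans (HF _ _) _.
    have := Hy s s0 k; rewrite -zy // -(ler_pM2l L0) => /le_trans; apply.
    by rewrite le_eqVlt; apply/orP; left; apply/eqP; ring.
  have h2 := Hy t t0 k.+1; rewrite -zy // half in h2.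
  rewrite -(subrKA (x k.+1 t)); apply: le_trans (ler_normD _ _) _.
  rewrite [X in X + _]distrC.
  have pk := ltW (p2 k).
  have : 0 <= B * 2 ^- k * E t by apply: mulr_ge0;
    [exact: mulr_ge0|exact: le_trans ler01 (E1 t t0)].
  by move: h1 h2; lra.
exists Y; first exact: next0.
by move=> t t0; rewrite Yy //; exact: dY.
Unshelve. all: by end_near. Qed.

End Picard.

Section CompactSupport.
Variable R : realType.

(** The partial derivatives are bounded, since they are continuous and vanish
    outside a ball; the Lipschitz bound follows by integration along segments. *)
Lemma lipschitz_compact_support n (G : 'cV[R]_n -> 'cV[R]_n) (M : R) : Ck 1 G ->
  (forall x, M < `|x| -> G x = 0) ->
  exists2 L : R, 0 < L & forall u v, `|G u - G v| <= L * `|u - v|.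
Proof.
move=> [dG DG] G0.
have /choice[C HC] : forall j : 'I_n, exists C : R, forall x : 'cV[R]_n,
  `|'D_(delta_mx j 0) G x| <= C.
  move=> j; pose D x := 'D_(delta_mx j 0) G x.
  have Dc : continuous D by exact: DG.
  pose A := [set x : 'cV[R]_n | `|x| <= Num.max M 0].
  have cA : compact A.
    apply: (@bounded_closed_compact_cV _ _ _ (Num.max M 0)) => //.
    apply: (@closed_comp _ _ (fun x : 'cV[R]_n => `|x|) [set t | t <= Num.max M 0]);
      last exact: closed_le.
    by move=> x _; exact: norm_continuous.
  have A0 : A !=set0 by exists 0; rewrite /A /= normr0 le_max lexx orbT.
  have nc : {within A, continuous (fun x => `|D x|)}.
    by apply: continuous_subspaceT => x; apply: continuous_comp;
      [exact: Dc|exact: norm_continuous].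
  have [c _ Hc] := compact_EVT_max A0 cA nc.
  exists `|D c| => x; have [xM|xM] := leP `|x| (Num.max M 0).
    by apply: Hc; rewrite inE.
  have -> : 'D_(delta_mx j 0) G x = 'D_(delta_mx j 0) (cst 0 : 'cV[R]_n -> 'cV[R]_n) x.
    apply: near_eq_derive; have xM' : M < `|x| by move: xM; rewrite gt_max => /andP[].
    exact: filterS (fun y => @G0 y) (near_norm_gt xM').
  by rewrite derive_cst normr0.
pose L := 1 + \sum_j `|C j|.
have L0 : 0 < L by rewrite ltr_pwDl // sumr_ge0.
exists L => // u v; pose w := u - v.
have dl (s : R) : is_derive s 1 (fun s => G (v + s *: w)) ('d G (v + s *: w) w).
  apply: is_derive_curve => //.
  have := is_deriveD (is_derive_cst v s 1) (is_derive_line w s).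
  by rewrite add0r.
have dg (s : R) : is_derive s 1 (fun s : R => L * `|w| * s) (L * `|w|).
  by have := is_deriveZ (L * `|w|) (is_derive_id s 1); rewrite [_ *: 1]mulr1.
have := @norm_primitive_le R n _ _ _ _ 1 ler01 (fun s _ => dl s) (fun s _ => dg s).
rewrite mulr0 subr0 mulr1 scale1r scale0r addr0 /w subrKC; apply.
move=> s _; rewrite diff_delta_sum //; apply: le_trans (ler_norm_sum _ _ _) _.
apply: (@le_trans _ _ (\sum_j `|C j| * `|u - v|)).
  apply: ler_sum => j _; rewrite normrZ mulrC; apply: ler_pM => //.
    by apply: le_trans (HC j _) _; exact: ler_norm.
  exact: coord_le_norm.
by rewrite -mulr_suml ler_wpM2r // /L lerDr.
Qed.

End CompactSupport.

(** * Global asymptotic stability from a Lyapunov function *)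

Section Lyapunov.
Variables (R : realType) (n : nat).
Implicit Types (F : 'cV[R]_n -> 'cV[R]_n) (V : 'cV[R]_n -> R).

Lemma lieE F V x : differentiable V x -> lie F V x = 'd V x (F x).
Proof.
by move=> dV; rewrite /lie -derive_grad // deriveE.
Qed.

Lemma continuous_lie F V : continuous F -> Ck 1 V -> continuous (lie F V).
Proof.
move=> Fc [_ DV].
have H : Ck 0 (fun x => grad V x *m F x).
  apply: Ck_mulmx => //; apply: Ck_mx => i j.
  by under eq_fun do rewrite mxE; exact: DV.
exact: (@Ck_coord _ _ _ _ 0 _ 0 0 H).
Qed.

Lemma within_continuous_comp (A : set R) (chi : R -> 'cV[R]_n) V :
  continuous V -> {within A, continuous chi} -> {within A, continuous (fun t => V (chi t))}.
Proof.
move=> Vc cc t; have ct := cc t.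
exact: (@continuous_comp _ _ _ (chi : subspace A -> _) V t ct (Vc _)).
Qed.

Lemma solution_MVT F V T chi (s t : R) : (forall x, differentiable V x) ->
  solution F T chi -> 0 <= s -> s < t -> (t%:E < T)%E ->
  exists2 r, s < r < t & V (chi t) - V (chi s) = lie F V (chi r) * (t - s).
Proof.
move=> dV [cc dc] s0 st tT.
have [||r /[!in_itv]/= rst E] := @MVT R (fun t => V (chi t)) (fun t => lie F V (chi t)) s t st.
- move=> r; rewrite in_itv /= => /andP[sr rt].
  rewrite lieE //; apply: is_derive_curve => //; apply: dc.
    exact: le_lt_trans sr.
  by apply: lt_trans tT; rewrite lte_fin.
- apply: within_continuous_comp; first by move=> x; exact: differentiable_continuous.
  apply: continuous_subspaceW cc => r /=; rewrite in_itv /= => /andP[sr rt]; split.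
    exact: le_trans sr.
  by apply: le_lt_trans tT; rewrite lee_fin.
by exists r.
Qed.

Lemma lyapunov_nonincreasing F V T chi (s t : R) : (forall x, differentiable V x) ->
  (forall x, lie F V x <= 0) -> solution F T chi -> 0 <= s -> s <= t -> (t%:E < T)%E ->
  V (chi t) <= V (chi s).
Proof.
move=> dV FV sol s0; rewrite le_eqVlt => /predU1P[->//|st] tT.
have [r _ E] := solution_MVT dV sol s0 st tT.
by rewrite -subr_le0 E mulr_le0_ge0 // subr_ge0 ltW.
Qed.

Lemma proper_bounded V (c : R) : proper_fun V -> posdef_fun V ->
  compact [set x | V x <= c] /\ exists M : R, forall x, V x <= c -> `|x| <= M.
Proof.
move=> pV [V0 Vp].
have Vge0 x : 0 <= V x by have [->|/Vp/ltW] := eqVneq x 0; rewrite ?V0.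
have cA : compact [set x | V x <= c].
  rewrite (_ : mkset _ = V @^-1` `[0, c]); first by apply: pV; exact: segment_compact.
  by apply/seteqP; split=> x /=; rewrite in_itv /= ?Vge0.
split=> //; have /compact_bounded[M [_ HM]] := cA.
by exists (M + 1) => x xc; apply: (HM (M + 1)) => //; rewrite ltrDl.
Qed.

(** Outside the ball, but inside a compact sublevel set, V has a positive
    minimum. *)
Lemma sublevel_small V (e : R) : continuous V -> proper_fun V -> posdef_fun V -> 0 < e ->
  exists2 c : R, 0 < c & forall x, V x < c -> `|x| < e.
Proof.
move=> Vc pV pd e0; have [cA _] := proper_bounded 1 pV pd.
pose A := [set x | V x <= 1] `&` [set x : 'cV[R]_n | e <= `|x|].
have cB : compact A.
  apply: compact_closedI => //.
  apply: (@closed_comp _ _ (fun x : 'cV[R]_n => `|x|) [set t | e <= t]); last exact: closed_ge.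
  by move=> x _; exact: norm_continuous.
have [A0|nA] := pselect (A !=set0); last first.
  exists 1 => // x x1; rewrite ltNge; apply/negP => ex; apply: nA; exists x; split=> //=.
  exact: ltW.
have [m mA Hm] := compact_EVT_min A0 cB (continuous_subspaceT Vc).
have m0 : m != 0.
  by move: mA; rewrite inE => -[_ /=]; apply: contraTneq => ->; rewrite normr0 -ltNge.
exists (Num.min 1 (V m)); first by rewrite lt_min ltr01 pd.2.
move=> x; rewrite lt_min => /andP[x1 xm]; rewrite ltNge; apply/negP => ex.
have : x \in A by rewrite inE; split=> //=; exact: ltW.
by move/Hm; rewrite leNgt xm.
Qed.

(** Lyapunov's direct method. For existence, F is cut off outside a sublevel set
    of V: the cut-off field has global solutions, V decreases along them too, so
    they never leave the region where both fields agree. Small sublevel sets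
    give stability. For attraction, V cannot stay above a positive level, as it
    decreases at a positive rate on the compact set between two levels. *)
Theorem gas_of_lyapunov F V : Ck 1 F -> F 0 = 0 -> Ck 1 V -> proper_fun V -> posdef_fun V ->
  (forall x, x != 0 -> lie F V x < 0) -> GAS F.
Proof.
move=> F1 F0 V1 pV pd FV.
have Vc : continuous V := Ck_continuous V1.
have Fc : continuous F := Ck_continuous F1.
have dV : forall x, differentiable V x := V1.1.
have Vge0 x : 0 <= V x by have [->|/pd.2/ltW] := eqVneq x 0; rewrite ?pd.1.
have FVle0 x : lie F V x <= 0.
  by have [->|/FV/ltW//] := eqVneq x 0; rewrite lieE // F0 linear0.
split.
- move=> chi0; pose c := V chi0.
  (* The factor is 1 on the sublevel set of chi0 and makes G vanish outside a
     compact set, hence globally Lipschitz. *)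
  pose G x := step (V x - c) *: F x.
  have G1 : Ck 1 G.
    have s1 : Ck 1 (fun x => step (V x - c)).
      exact: (Ck_comp_real (Ck_step R 1) (CkB V1 (Ck_cst _ 1 c))).
    exact: (CkZ s1 F1).
  have [_ [M HM]] := proper_bounded (c + 2) pV pd.
  have GM x : M < `|x| -> G x = 0.
    move=> Mx; rewrite /G step_eq0 ?scale0r // lerBrDr addrC leNgt.
    by apply/negP => /ltW/HM; rewrite leNgt Mx.
  have [L L0 HL] := lipschitz_compact_support G1 GM.
  have [Y Y0 dY] := picard_global chi0 L0 HL.
  have GV x : lie G V x <= 0.
    rewrite lieE // /G linearZ /= -lieE // mulr_ge0_le0 //; exact: step_ge0.
  have Yc : {within [set t : R | 0 <= t /\ (t%:E < +oo)%E], continuous Y}.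
    apply: continuous_in_subspaceT => t; rewrite inE => -[t0 _].
    apply: differentiable_continuous; apply/derivable1_diffP.
    exact: (@ex_derive _ _ _ _ _ _ _ (dY t t0)).
  have solY : solution G +oo%E Y by split=> // t t0 _; apply: dY; exact: ltW.
  exists Y => //; split=> // t t0 _.
  have := dY t (ltW t0); rewrite /G step_eq1 ?scale1r //.
  rewrite lerBlDr; apply: (@le_trans _ _ (V (Y 0))); last by rewrite Y0 lerDr.
  by apply: (lyapunov_nonincreasing dV GV solY) => //; [exact: ltW|rewrite ltry].
- move=> e e0; have [c c0 Hc] := sublevel_small Vc pV pd e0.
  have /nbhs_normP[d d0 Hd] : \forall x \near (0 : 'cV[R]_n), V x < c.
    by apply: (cvgr_lt _ (Vc 0)); rewrite pd.1.
  exists d => // T chi T0 sol chid t t0 tT; apply: Hc.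
  apply: (@le_lt_trans _ _ (V (chi 0))).
    exact: (lyapunov_nonincreasing dV FVle0 sol).
  by apply: Hd; rewrite /= sub0r normrN.
move=> chi sol; apply/cvgrPdist_lt => e e0.
have [c c0 Hc] := sublevel_small Vc pV pd e0.
have mono (s t : R) : 0 <= s -> s <= t -> V (chi t) <= V (chi s).
  by move=> s0 st; apply: (lyapunov_nonincreasing dV FVle0 sol) => //; rewrite ltry.
suff [T T0 VT] : exists2 T : R, 0 <= T & V (chi T) < c.
  exists T; split=> [|t Tt]; first exact: num_real.
  by rewrite sub0r normrN; apply: Hc; apply: le_lt_trans VT; apply: mono => //; exact: ltW.
apply: contrapT => nT.
have Vc_ge (t : R) : 0 <= t -> c <= V (chi t).
  by move=> t0; rewrite leNgt; apply/negP => Vt; apply: nT; exists t.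
pose A := [set x | V x <= V (chi 0)] `&` [set x | c <= V x].
have cA : compact A.
  apply: compact_closedI; first by have [] := proper_bounded (V (chi 0)) pV pd.
  apply: (@closed_comp _ _ V [set t | c <= t]); last exact: closed_ge.
  by move=> x _; exact: Vc.
have A0 : A !=set0 by exists (chi 0); split=> //=; exact: Vc_ge.
have [m mA Hm] := compact_EVT_max A0 cA (continuous_subspaceT (continuous_lie Fc V1)).
(* If V stayed above c, it would decrease at a rate at least eta forever. *)
pose eta := - lie F V m.
have eta0 : 0 < eta.
  rewrite oppr_gt0; apply: FV; move: mA; rewrite inE => -[_ /=].
  by apply: contraTneq => ->; rewrite pd.1 -ltNge.
have decay (t : R) : 0 < t -> V (chi t) <= V (chi 0) - eta * t.
  move=> t0; have [|r /andP[r0 rt]] := solution_MVT dV sol (lexx 0) t0; first by rewrite ltry.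
  rewrite subr0 => E; rewrite -lerBlDl E -mulNr ler_pM2r // /eta opprK; apply: Hm.
  by rewrite inE; split=> /=; [exact/mono/ltW|exact/Vc_ge/ltW].
have t0 : 0 < (V (chi 0) + 1) / eta by rewrite divr_gt0 // ltr_wpDl.
have := decay _ t0; rewrite mulrCA divff ?mulr1 ?gt_eqF //.
by have := Vge0 (chi ((V (chi 0) + 1) / eta)); lra.
Qed.

End Lyapunov.

(** * The Lyapunov matrix inequality *)

Section LyapunovEquation.
Variable R : realType.

(** Tr + i Ti is a lower triangular complex matrix whose eigenvalues have
    negative real part, acting on a + i b. With weights w i = e^(2 i) and e
    small, the entries below the diagonal are negligible compared to the
    diagonal ones. *)
Lemma trig_dissipative n (Tr Ti : 'M[R]_n) :
  (forall i j : 'I_n, (i < j)%N -> Tr i j = 0 /\ Ti i j = 0) -> (forall i, Tr i i < 0) ->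
  exists w : 'I_n -> R, (forall i, 0 < w i) /\
    forall a b : 'cV[R]_n, (a != 0) || (b != 0) ->
      \sum_i w i * (a i 0 * (Tr *m a - Ti *m b) i 0 + b i 0 * (Ti *m a + Tr *m b) i 0) < 0.
Proof.
move=> Ttrig Tneg.
pose K := \sum_i \sum_j (Tr i j ^+ 2 + Ti i j ^+ 2).
have t0 i j : 0 <= Tr i j ^+ 2 + Ti i j ^+ 2 by rewrite addr_ge0 // sqr_ge0.
have K0 : 0 <= K by apply: sumr_ge0 => i _; apply: sumr_ge0.
have TK i j : Tr i j ^+ 2 + Ti i j ^+ 2 <= K.
  rewrite /K (bigD1 i) //= (bigD1 j) //= -addrA lerDl addr_ge0 //.
    by apply: sumr_ge0.
  by apply: sumr_ge0 => k _; apply: sumr_ge0.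
(* A positive lower bound of the numbers - Tr i i. *)
pose m := (1 + \sum_i (- Tr i i)^-1)^-1.
have inv0 i : 0 <= (- Tr i i)^-1 by rewrite invr_ge0 oppr_ge0 ltW.
have m0 : 0 < m by rewrite invr_gt0 ltr_pwDl // sumr_ge0.
have Tm i : Tr i i <= - m.
  rewrite lerNr -[leRHS]invrK lef_pV2 ?posrE ?invr_gt0 ?oppr_gt0 ?ltr_pwDl ?sumr_ge0 //.
  by rewrite (bigD1 i) //= addrCA lerDl addr_ge0 // sumr_ge0.
pose e := Num.min 1 (m / (n%:R * (1 + K) + 1)).
have d0 : 0 < n%:R * (1 + K) + 1 by rewrite ltr_wpDl // mulr_ge0 ?ler0n // addr_ge0.
have e0 : 0 < e by rewrite lt_min ltr01 divr_gt0.
have e1 : e <= 1 by rewrite ge_min lexx.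
have en : e * (n%:R * (1 + K)) < m.
  apply: (@lt_le_trans _ _ (e * (n%:R * (1 + K) + 1))); first by rewrite ltr_pM2l // ltrDl.
  by rewrite -ler_pdivlMr // ge_min lexx orbT.
pose w (i : 'I_n) : R := (e ^+ 2) ^+ i.
have w0 i : 0 < w i by rewrite !exprn_gt0.
have wij (i j : 'I_n) : (j < i)%N -> w i <= e ^+ 2 * w j.
  by move=> ji; rewrite -exprS ler_wiXn2l // ?exprn_ge0 ?(ltW e0) // exprn_ile1 // ltW.
exists w; split=> // a b ab.
pose N i := a i 0 ^+ 2 + b i 0 ^+ 2.
have N0 i : 0 <= N i by rewrite addr_ge0 // sqr_ge0.
pose q := \sum_i w i * N i.
have q0 : 0 < q.
  have wN i : 0 <= w i * N i by rewrite mulr_ge0 // ltW.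
  rewrite lt_neqAle eq_sym sumr_ge0 // andbT; apply: contraTneq ab => /eqP.
  rewrite psumr_eq0 // => /allP H; rewrite negb_or !negbK.
  have ab0 i : a i 0 = 0 /\ b i 0 = 0.
    have := H i (mem_index_enum i); rewrite mulf_eq0 gt_eqF //= paddr_eq0 ?sqr_ge0 //.
    by rewrite !sqrf_eq0 => /andP[/eqP -> /eqP ->].
  by apply/andP; split; apply/eqP/matrixP => i j; rewrite (ord1 j) mxE; case: (ab0 i).
pose term i j := w i * (a i 0 * (Tr i j * a j 0 - Ti i j * b j 0)
  + b i 0 * (Ti i j * a j 0 + Tr i j * b j 0)).
have -> : \sum_i w i * (a i 0 * (Tr *m a - Ti *m b) i 0 + b i 0 * (Ti *m a + Tr *m b) i 0)
    = \sum_i \sum_j term i j.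
  apply: eq_bigr => i _; rewrite /term -mulr_sumr big_split /= -!mulr_sumr;
    congr (_ * (_ * _ + _ * _)).
    by rewrite !mxE -sumrB.
  by rewrite !mxE -big_split.
have bound i j : 2 * term i j <=
    (if i == j then 2 * (w i * Tr i i * N i) else 0) + e * (w i * N i + K * (w j * N j)).
  have r0 : 0 <= e * (w i * N i + K * (w j * N j)).
    by rewrite mulr_ge0 ?(ltW e0) // addr_ge0 // !mulr_ge0 // ltW.
  have [ij|ij] := eqVneq i j.
    rewrite -ij in r0 *.
    have -> : term i i = w i * Tr i i * N i by rewrite /term /N; ring.
    by rewrite lerDl.
  rewrite add0r; have [ltij|ltji|/val_inj/eqP] := ltngtP i j; last by rewrite (negbTE ij).
    by have [z1 z2] := Ttrig i j ltij; rewrite /term z1 z2 !mul0r subr0 addr0 !mulr0 addr0 !mulr0.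
  set u1 := Tr i j * a j 0 - Ti i j * b j 0; set u2 := Ti i j * a j 0 + Tr i j * b j 0.
  have uN : u1 ^+ 2 + u2 ^+ 2 <= K * N j.
    have -> : u1 ^+ 2 + u2 ^+ 2 = (Tr i j ^+ 2 + Ti i j ^+ 2) * N j by rewrite /u1 /u2 /N; ring.
    by rewrite ler_wpM2r.
  have amgm : 2 * (a i 0 * u1 + b i 0 * u2) <= e * N i + (u1 ^+ 2 + u2 ^+ 2) / e.
    rewrite -subr_ge0 (_ : _ - _ = ((e * a i 0 - u1) ^+ 2 + (e * b i 0 - u2) ^+ 2) / e).
      by rewrite divr_ge0 ?(ltW e0) // addr_ge0 // sqr_ge0.
    by rewrite /N; field; rewrite gt_eqF.
  have -> : 2 * term i j = w i * (2 * (a i 0 * u1 + b i 0 * u2)) by rewrite /term -/u1 -/u2; ring.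
  apply: (@le_trans _ _ (w i * (e * N i + K * N j / e))).
    rewrite ler_pM2l //; apply: le_trans amgm _; rewrite lerD2l ler_pM2r ?invr_gt0 //.
  have -> : w i * (e * N i + K * N j / e) = e * (w i * N i) + w i * (K * N j / e) by ring.
  rewrite [e * (w i * N i + _)]mulrDr lerD2l.
  have -> : e * (K * (w j * N j)) = e ^+ 2 * w j * (K * N j / e) by field; rewrite gt_eqF.
  by rewrite ler_wpM2r ?wij // divr_ge0 ?(ltW e0) // mulr_ge0.
have S : 2 * \sum_i \sum_j term i j <= - 2 * m * q + e * (n%:R * (1 + K)) * q.
  rewrite mulr_sumr; apply: (@le_trans _ _ (\sum_i (- 2 * m * (w i * N i) +
    e * (n%:R * (w i * N i) + K * q)))).
    apply: ler_sum => i _; rewrite mulr_sumr.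
    apply: le_trans (ler_sum _ (fun j _ => bound i j)) _.
    rewrite big_split /= -mulr_sumr big_split /= -mulr_sumr sumr_const card_ord -[_ *+ n]mulr_natl.
    have -> : \sum_(j < n) (if i == j then 2 * (w i * Tr i i * N i) else 0) =
      2 * (w i * Tr i i * N i).
      by rewrite -big_mkcond /= (big_pred1 i) // => j; rewrite pred1E eq_sym.
    rewrite -mulr_sumr -/q.
    have := Tm i; rewrite -(ler_pM2r (w0 i)) => H.
    by have := ler_wpM2r (N0 i) H; lra.
  rewrite big_split /= -mulr_sumr -/q lerD2l -mulr_sumr big_split /= -mulr_sumr -/q.
  rewrite sumr_const card_ord -[_ *+ n]mulr_natl le_eqVlt; apply/orP; left; apply/eqP; ring.
have : e * (n%:R * (1 + K)) * q < m * q by rewrite ltr_pM2r.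
have : 0 < m * q by rewrite mulr_gt0.
by move: S; lra.
Qed.


Lemma ReM_sum (I : finType) (x y : I -> R[i]) :
  complex.Re (\sum_k x k * y k) =
    \sum_k (complex.Re (x k) * complex.Re (y k) - complex.Im (x k) * complex.Im (y k)).
Proof.
rewrite (big_morph (@complex.Re R) (id1 := 0) (op1 := +%R)) //; last by move=> [? ?] [? ?].
by apply: eq_bigr => k _; case: (x k) => ? ?; case: (y k).
Qed.

Lemma ImM_sum (I : finType) (x y : I -> R[i]) :
  complex.Im (\sum_k x k * y k) =
    \sum_k (complex.Re (x k) * complex.Im (y k) + complex.Im (x k) * complex.Re (y k)).
Proof.
rewrite (big_morph (@complex.Im R) (id1 := 0) (op1 := +%R)) //; last by move=> [? ?] [? ?].
by apply: eq_bigr => k _; case: (x k) => ? ?; case: (y k).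
Qed.

(** A unitary matrix S makes M triangular over the complex numbers, and the
    weighted Hermitian norm of S v, for the weights of [trig_dissipative], is a
    real quadratic form in the real vector v that decreases along
    the solutions of dv/dt = M v. *)
Theorem lyapunov_equation n (M : 'M[R]_n) : hurwitz M ->
  exists P, posdef_mx P /\ negdef_mx (P *m M + M^T *m P).
Proof.
case: n M => [|n] M hM.
  have cV0 (v : 'cV[R]_0) : v = 0 by apply/matrixP => -[].
  exists 0; split; split.
  - by rewrite trmx0.
  - by move=> v; rewrite (cV0 v) eqxx.
  - by rewrite mulmx0 mul0mx addr0 trmx0.
  - by move=> v; rewrite (cV0 v) eqxx.
pose MC := map_mx (real_complex R) M.
have [S uS trT] := Schur MC (ltn0Sn n).
have Su : S \in unitmx by exact: unitarymx_unit.
pose T := conjmx S MC.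
have ST : S *m MC = T *m S by rewrite /T conjumx // mulmxKV.
have Ttrig : is_trig_mx T by exact: trT.
have Teig i : complex.Re (T i i) < 0.
  apply: hM; apply: (@eigenvalue_conjmx _ _ _ S MC).
  - exact: stablemx_unit.
  - by rewrite row_free_unit.
  rewrite -[_ \in _]/(eigenvalue _ _) eigenvalue_root_char -/T char_poly_trig //.
  by rewrite rootE horner_prod (bigD1 i) //= hornerXsubC subrr mul0r.
clearbody T.
pose Tr := map_mx (@complex.Re R) T; pose Ti := map_mx (@complex.Im R) T.
pose A := map_mx (@complex.Re R) S; pose B := map_mx (@complex.Im R) S.
have AM : A *m M = Tr *m A - Ti *m B.
  apply/matrixP => i j; have := congr1 (fun X : matrix _ _ _ => complex.Re (X i j)) ST.
  rewrite !mxE !ReM_sum -sumrB => E;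
    rewrite (_ : (\sum_(k < n.+1) A i k * M k j) =
    \sum_(k < n.+1) (complex.Re (S i k) * complex.Re (MC k j) - complex.Im (S i k) * complex.Im (MC k j))).
    by rewrite E; apply: eq_bigr => k _; rewrite !mxE.
  by apply: eq_bigr => k _; rewrite !mxE /= mulr0 subr0.
have BM : B *m M = Ti *m A + Tr *m B.
  apply/matrixP => i j; have := congr1 (fun X : matrix _ _ _ => complex.Im (X i j)) ST.
  rewrite !mxE !ImM_sum -big_split /= => E;
    rewrite (_ : (\sum_(k < n.+1) B i k * M k j) =
    \sum_(k < n.+1) (complex.Re (S i k) * complex.Im (MC k j) +
    complex.Im (S i k) * complex.Re (MC k j))).
    by rewrite E; apply: eq_bigr => k _; rewrite !mxE addrC.
  by apply: eq_bigr => k _; rewrite !mxE /= mulr0 add0r.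
have [i j|i|w [w0 Hw]] := @trig_dissipative _ Tr Ti.
- by move=> ij; rewrite !mxE (is_trig_mxP Ttrig).
- by rewrite mxE.
pose W := diag_mx (\row_i w i).
pose P := A^T *m W *m A + B^T *m W *m B.
have WE (u v : 'cV[R]_n.+1) : (u^T *m W *m v) 0 0 = \sum_i w i * (u i 0 * v i 0).
  rewrite mxE; apply: eq_bigr => i _; rewrite mul_mx_diag !mxE; ring.
have PE (u v : 'cV[R]_n.+1) : (u^T *m P *m v) 0 0 =
    \sum_i w i * ((A *m u) i 0 * (A *m v) i 0 + (B *m u) i 0 * (B *m v) i 0).
  rewrite /P mulmxDr mulmxDl mxE.
  have -> : u^T *m (A^T *m W *m A) *m v = (A *m u)^T *m W *m (A *m v).
    by rewrite trmx_mul !mulmxA.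
  have -> : u^T *m (B^T *m W *m B) *m v = (B *m u)^T *m W *m (B *m v).
    by rewrite trmx_mul !mulmxA.
  by rewrite !WE -big_split; apply: eq_bigr => i _; rewrite mulrDr.
have PT : P^T = P.
  by rewrite /P linearD /= !trmx_mul !trmxK tr_diag_mx !mulmxA.
(* A v and B v are the real and imaginary parts of S v, and S is invertible. *)
have AB0 (v : 'cV[R]_n.+1) : v != 0 -> (A *m v != 0) || (B *m v != 0).
  apply: contraNT; rewrite negb_or !negbK => /andP[/eqP Av /eqP Bv].
  have Sv : S *m map_mx (real_complex R) v = 0.
    apply/matrixP => i j; rewrite mxE [RHS]mxE; apply/eqP; rewrite eq_complex ReM_sum ImM_sum.
    have := congr1 (fun X : matrix _ _ _ => X i j) Av;
      have := congr1 (fun X : matrix _ _ _ => X i j) Bv.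
    rewrite !mxE => Bi Ai; apply/andP; split; apply/eqP.
      rewrite -[RHS]Ai; apply: eq_bigr => k _; by rewrite !mxE /= mulr0 subr0.
    by rewrite -[RHS]Bi; apply: eq_bigr => k _; rewrite !mxE /= mulr0 add0r.
  have : map_mx (real_complex R) v = 0 by rewrite -[LHS](mulKmx Su) Sv mulmx0.
  by move/eqP; rewrite map_mx_eq0.
exists P; split; split=> //.
- move=> v /AB0 v0; rewrite PE.
  have ge0 i : 0 <= w i * ((A *m v) i 0 * (A *m v) i 0 + (B *m v) i 0 * (B *m v) i 0).
    by rewrite mulr_ge0 ?(ltW (w0 i)) // addr_ge0 // -expr2 sqr_ge0.
  rewrite lt_neqAle eq_sym sumr_ge0 // andbT; apply: contraTneq v0 => /eqP.
  rewrite psumr_eq0 // => /allP H; rewrite negb_or !negbK.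
  have ab0 i : (A *m v) i 0 = 0 /\ (B *m v) i 0 = 0.
    have := H i (mem_index_enum i); rewrite mulf_eq0 gt_eqF //= -!expr2 paddr_eq0 ?sqr_ge0 //.
    by rewrite !sqrf_eq0 => /andP[/eqP -> /eqP ->].
  by apply/andP; split; apply/eqP/matrixP => i j; rewrite (ord1 j) [RHS]mxE; case: (ab0 i).
- by rewrite linearD /= !trmx_mul trmxK PT addrC.
move=> v /AB0 v0; rewrite mulmxDr mulmxDl mxE.
have -> : (v^T *m (M^T *m P) *m v) 0 0 = (v^T *m (P *m M) *m v) 0 0.
  rewrite -[in LHS](trmxK (v^T *m (M^T *m P) *m v)) [LHS]mxE !trmx_mul !trmxK PT.
  by rewrite !mulmxA.
have -> : (v^T *m (P *m M) *m v) 0 0 = (v^T *m P *m (M *m v)) 0 0 by rewrite !mulmxA.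
have AMv : A *m (M *m v) = Tr *m (A *m v) - Ti *m (B *m v).
  by rewrite mulmxA AM mulmxBl !mulmxA.
have BMv : B *m (M *m v) = Ti *m (A *m v) + Tr *m (B *m v).
  by rewrite mulmxA BM mulmxDl !mulmxA.
have := Hw _ _ v0; rewrite PE AMv BMv => H.
by rewrite -mulr2n pmulrn_llt0.
Qed.

End LyapunovEquation.

(** * Decrease of a Lyapunov function near the origin *)

Section LocalDecrease.
Variable R : realType.

(** Maximum over the unit sphere, and homogeneity. *)
Lemma negdef_bound n (Q : 'M[R]_n) : negdef_mx Q ->
  exists2 mu : R, 0 < mu & forall x : 'cV[R]_n, (x^T *m Q *m x) 0 0 <= - mu * `|x| ^+ 2.
Proof.
move=> [_ HQ]; pose q (x : 'cV[R]_n) := (x^T *m Q *m x) 0 0.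
have qc : continuous q.
  apply: (@Ck_coord _ _ _ _ 0); apply: (@Ck_mulmx _ _ _ _ _ 0).
    apply: (@Ck_linear_mx _ _ _ _ 0) => c u v.
    by rewrite linearP /= mulmxDl scalemxAl.
  by apply: (@Ck_linear_mx _ _ _ _ 0).
pose S := [set x : 'cV[R]_n | `|x| = 1].
have cS : compact S.
  apply: (@bounded_closed_compact_cV _ _ _ 1) => [x /= ->//|].
  apply: (@closed_comp _ _ (fun x : 'cV[R]_n => `|x|) [set t | t = 1]); last exact: closed_eq.
  by move=> x _; exact: norm_continuous.
have unit_in (x : 'cV[R]_n) : x != 0 -> S (`|x|^-1 *: x).
  by move=> x0; rewrite /S /= normrZ normfV normr_id mulVf // normr_eq0.
have [S0|nS] := pselect (S !=set0); last first.
  exists 1 => // x; have [->|x0] := eqVneq x 0; first by rewrite mulmx0 mxE normr0 expr0n mulr0.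
  by exfalso; apply: nS; exists (`|x|^-1 *: x); exact: unit_in.
have [m mS Hm] := compact_EVT_max S0 cS (continuous_subspaceT qc).
exists (- q m).
  rewrite oppr_gt0; apply: HQ; move: mS; rewrite inE /S /= => m1.
  by rewrite -normr_gt0 m1.
move=> x; have [->|x0] := eqVneq x 0; first by rewrite mulmx0 mxE normr0 expr0n mulr0.
have nx : 0 < `|x| by rewrite normr_gt0.
have := Hm (`|x|^-1 *: x); rewrite inE => /(_ (unit_in x x0)).
have -> : q (`|x|^-1 *: x) = `|x| ^- 2 * q x.
  rewrite /q (_ : (_ *: x)^T = `|x|^-1 *: x^T); last by apply/matrixP => i j; rewrite !mxE.
  rewrite -!scalemxAl -scalemxAr scalerA [LHS]mxE.
  by rewrite -expr2 exprVn.
by rewrite opprK ler_pdivrMl ?exprn_gt0 // mulrC.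
Qed.

(** The origin is a minimum of V. *)
Lemma derive_posdef0 n (V : 'cV[R]_n -> R) (v : 'cV[R]_n) :
  (forall x, differentiable V x) -> posdef_fun V -> 'D_v V 0 = 0.
Proof.
move=> dV [V0 Vp].
have dl (s : R) : is_derive s 1 (fun s => V (s *: v)) ('d V (s *: v) v).
  by apply: is_derive_curve => //; exact: is_derive_line.
have d0 : is_derive (0 : R) 1 (fun s : R => V (s *: v)) 0.
  apply: (@derive1_at_min _ _ (-1) 1).
  - by rewrite (le_trans _ ler01) // oppr_le0.
  - by move=> t _; exact: (@ex_derive _ _ _ _ _ _ _ (dl t)).
  - by rewrite in_itv /= oppr_lt0 ltr01.
  move=> t _; rewrite scale0r V0; have [->|/Vp/ltW//] := eqVneq (t *: v) 0.
  by rewrite V0.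
have := @derive_val _ _ _ _ _ _ _ (dl 0).
by rewrite (@derive_val _ _ _ _ _ _ _ d0) scale0r -deriveE.
Qed.

(** The gradient of V is 2 x^T P and F is M x up to errors that are small
    compared to the norm of x; hence the derivative of V along F is the form
    of P M + M^T P up to an error small compared to the squared norm. *)
Theorem local_decrease n (V : 'cV[R]_n -> R) (F : 'cV[R]_n -> 'cV[R]_n) (P M : 'M[R]_n) :
  Ck 2 V -> posdef_fun V -> hessian V 0 = 2 *: P -> differentiable F 0 -> F 0 = 0 ->
  jac F 0 = M -> negdef_mx (P *m M + M^T *m P) -> P^T = P ->
  exists2 r : R, 0 < r & forall x, x != 0 -> `|x| < r -> lie F V x < 0.
Proof.
move=> V2 pd hV dF F0 jF nd PT.
have DV0 j : 'D_(delta_mx j 0) V 0 = 0.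
  by apply: derive_posdef0 => //; exact: V2.1.
have dFM x : 'd F 0 x = M *m x by rewrite -deriveE // derive_jac // jF.
have [mu mu0 Hmu] := negdef_bound nd.
(* e * C * `|x| ^+ 2 dominates the two error terms that arise when F and the
   gradient are replaced by their linear parts. *)
pose C := n%:R * (n%:R * `|M| + 1 + n%:R * `|2 *: P|) + 1.
have C0 : 0 < C by rewrite ltr_wpDl // mulr_ge0 // !addr_ge0 // mulr_ge0.
pose e := Num.min 1 (mu / C).
have e0 : 0 < e by rewrite lt_min ltr01 divr_gt0.
have e1 : e <= 1 by rewrite ge_min lexx.
have eC : e * C <= mu by rewrite -ler_pdivlMr // ge_min lexx orbT.
have HF : \forall x \near (0 : 'cV[R]_n), `|F x - M *m x| <= e * `|x|.
  have := differentiable_approx dF e0; apply: filterS => x.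
  by rewrite add0r F0 subr0 dFM.
have HVj j : \forall x \near (0 : 'cV[R]_n), `|(grad V x - x^T *m (2 *: P)) 0 j| <= e * `|x|.
  have dj := (V2.2 (delta_mx j 0)).1 0.
  have := differentiable_approx dj e0; apply: filterS => x.
  rewrite add0r DV0 subr0 -deriveE // hessianE // hV -colE [col _ _ _ _]mxE.
  rewrite [(grad V x - _) 0 j]mxE [grad V x 0 j]mxE. by rewrite [X in _ -> `|_ + X| <= _]mxE.
have HV : \forall x \near (0 : 'cV[R]_n), forall j,
  `|(grad V x - x^T *m (2 *: P)) 0 j| <= e * `|x|.
  exact: filter_forall HVj.
have /nbhs_normP[r /= r0 Hr] : \forall x \near (0 : 'cV[R]_n), `|F x - M *m x| <= e * `|x| /\
    forall j, `|(grad V x - x^T *m (2 *: P)) 0 j| <= e * `|x|.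
  by apply: filterS2 HF HV.
exists r => // x x0 xr; have [|hF hV'] := Hr x; first by rewrite /= sub0r normrN.
have nx : 0 < `|x| by rewrite normr_gt0.
have hG : `|grad V x - x^T *m (2 *: P)| <= e * `|x|.
  rewrite [leLHS]/Num.Def.normr /= mx_normrE; apply: bigmax_le => [|[i j] _];
    first by rewrite mulr_ge0 // ltW.
  by rewrite (ord1 i) /=; exact: hV'.
set g := grad V x in hG *; set Q := 2 *: P in hG *.
have -> : lie F V x = (x^T *m (P *m M + M^T *m P) *m x) 0 0
    + (((g - x^T *m Q) *m F x) 0 0 + (x^T *m Q *m (F x - M *m x)) 0 0).
  rewrite /lie -/g.
  have -> : (x^T *m (P *m M + M^T *m P) *m x) 0 0 = (x^T *m Q *m (M *m x)) 0 0.
    rewrite mulmxDr mulmxDl [LHS]mxE /Q -scalemxAr -!scalemxAl [RHS]mxE.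
    have -> : (x^T *m (M^T *m P) *m x) 0 0 = (x^T *m (P *m M) *m x) 0 0.
      rewrite -[in LHS](trmxK (x^T *m (M^T *m P) *m x)) [LHS]mxE !trmx_mul !trmxK PT.
      by rewrite !mulmxA.
    by rewrite !mulmxA; lra.
  by rewrite mulmxBl mulmxBr !mxE; lra.
have nF : `|F x| <= (n%:R * `|M| + 1) * `|x|.
  rewrite -(subrK (M *m x) (F x)); apply: le_trans (ler_normD _ _) _.
  have h := mx_norm_mul M x; have h2 := ler_wpM2r (ltW nx) e1; move: h h2 hF; lra.
have b1 : ((g - x^T *m Q) *m F x) 0 0 <= n%:R * (e * `|x| * ((n%:R * `|M| + 1) * `|x|)).
  apply: le_trans (ler_norm _) _; apply: le_trans (coord_le_norm _ _ _) _.
  apply: le_trans (mx_norm_mul _ _) _; rewrite ler_wpM2l // ler_pM //.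
have b2 : (x^T *m Q *m (F x - M *m x)) 0 0 <= n%:R * (n%:R * (`|x| * `|Q|) * (e * `|x|)).
  apply: le_trans (ler_norm _) _; apply: le_trans (coord_le_norm _ _ _) _.
  apply: le_trans (mx_norm_mul _ _) _; rewrite ler_wpM2l // ler_pM //.
  apply: le_trans (mx_norm_mul _ _) _; rewrite ler_wpM2l // ler_pM //.
  exact: mx_norm_tr.
have x2 : 0 < `|x| ^+ 2 by rewrite exprn_gt0.
have h1 := Hmu x.
have h2 : e * C * `|x| ^+ 2 <= mu * `|x| ^+ 2 by rewrite ler_pM2r.
have h3 : 0 < e * `|x| ^+ 2 by rewrite mulr_gt0.
move: h1 h2 h3 b1 b2; rewrite /C -/Q; lra.
Qed.

End LocalDecrease.

(** * Schur complement and backstepping *)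

Section SchurComplement.
Variables (R : realType) (n : nat).

(** The embedding of R^n onto the subspace x = K y. *)
Definition graph_mx (K : 'rV[R]_n) : 'M[R]_(n + 1, n) := col_mx 1%:M K.

Lemma graph_mx_eq0 (K : 'rV[R]_n) (v : 'cV[R]_n) : v != 0 -> graph_mx K *m v != 0.
Proof.
apply: contra => /eqP H; have := congr1 (@usubmx _ _ _ _) H.
by rewrite /graph_mx mul_col_mx col_mxKu mul1mx linear0 => ->.
Qed.

(** Completing the square in the last variable: the subspace x = K y is the
    P-orthogonal of the last axis and Q is the restriction of P to it. *)
Lemma schur_complement (P : 'M[R]_(n + 1)) : posdef_mx P ->
  exists (K : 'rV[R]_n) (Q : 'M[R]_n) (p : R),
  [/\ 0 < p, posdef_mx Q, P *m graph_mx K = col_mx Q 0 &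
    forall v w : 'cV[R]_(n + 1), (v^T *m P *m w) 0 0 =
      ((usubmx v)^T *m Q *m usubmx w) 0 0 +
      p * ((dsubmx v 0 0 - (K *m usubmx v) 0 0) * (dsubmx w 0 0 - (K *m usubmx w) 0 0))].
Proof.
move=> [PT Pp].
pose p := drsubmx P 0 0.
have drP : drsubmx P = p%:M by rewrite [LHS]mx11_scalar.
pose e : 'cV[R]_(n + 1) := col_mx 0 1%:M.
have Pe : P *m e = col_mx (ursubmx P) p%:M.
  by rewrite -{1}[P]submxK /e mul_block_col !mulmx0 !add0r !mulmx1 drP.
have pE : (e^T *m P *m e) 0 0 = p.
  rewrite -mulmxA Pe /e tr_col_mx mul_row_col trmx0 mul0mx add0r trmx1 mul1mx mxE.
  by rewrite eqxx.
have p0 : 0 < p.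
  rewrite -pE; apply: Pp; apply/eqP => /(congr1 (@dsubmx _ _ _ _)).
  rewrite col_mxKd linear0 => /(congr1 (fun X : 'M[R]_1 => X 0 0)); rewrite !mxE eqxx.
  by move/eqP; rewrite oner_eq0.
pose K : 'rV[R]_n := - p^-1 *: dlsubmx P.
pose E := graph_mx K.
pose Q := E^T *m P *m E.
have PEd : P *m E = col_mx (ulsubmx P + ursubmx P *m K) 0.
  rewrite -{1}[P]submxK /E /graph_mx mul_block_col !mulmx1 drP; congr col_mx.
  by rewrite mul_scalar_mx /K scalerA mulrN divff ?gt_eqF // scaleN1r subrr.
have PE : P *m E = col_mx Q 0.
  rewrite PEd /Q -mulmxA PEd /E /graph_mx tr_col_mx mul_row_col mulmx0 addr0 trmx1.
  by rewrite mul1mx.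
have QT : Q^T = Q by rewrite /Q !trmx_mul trmxK PT mulmxA.
exists K, Q, p; split=> //.
  split=> // v v0; have := Pp _ (graph_mx_eq0 K v0).
  by rewrite /Q trmx_mul !mulmxA.
(* The graph of K and the last axis are P-orthogonal. *)
have decomp (v : 'cV[R]_(n + 1)) :
    v = E *m usubmx v + (dsubmx v 0 0 - (K *m usubmx v) 0 0) *: e.
  rewrite -[LHS]vsubmxK /E /graph_mx mul_col_mx mul1mx /e scale_col_mx add_col_mx.
  rewrite scaler0 addr0; congr col_mx; apply/matrixP => i j; rewrite (ord1 i) (ord1 j).
  by rewrite [RHS]mxE [X in _ + X]mxE [1%:M 0 0]mxE eqxx mulr1 addrC subrK.
move=> v w; set a := dsubmx v 0 0 - _; set b := dsubmx w 0 0 - _.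
have eTPE : e^T *m P *m E = 0.
  by rewrite -mulmxA PE /e tr_col_mx mul_row_col mulmx0 trmx0 mul0mx addr0.
have ETPe : E^T *m P *m e = 0.
  by apply: trmx_inj; rewrite !trmx_mul trmxK PT trmx0 mulmxA.
rewrite [in LHS](decomp v) [in LHS](decomp w) -/a -/b.
rewrite [(_ + _)^T]linearD /= mulmxDl mulmxDl !mulmxDr.
rewrite [(a *: e)^T]linearZ /= -!scalemxAl -!scalemxAr.
have -> : (E *m usubmx v)^T *m P *m e = 0.
  by rewrite trmx_mul -!mulmxA (mulmxA _ P) ETPe mulmx0.
have -> : e^T *m P *m (E *m usubmx w) = 0 by rewrite mulmxA eTPE mul0mx.
rewrite !scaler0 addr0 add0r scalerA [LHS]mxE [X in _ + X]mxE pE [_ * p]mulrC.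
congr (_ + _).
by rewrite /Q trmx_mul !mulmxA.
Qed.

(** Restriction of P M + M^T P to the subspace x = K y: as P maps this subspace
    into the first coordinates, only the first block row of M contributes. *)
Lemma schur_complement_negdef (P M : 'M[R]_(n + 1)) (K : 'rV[R]_n) (Q H1 : 'M[R]_n)
    (H2 : 'cV[R]_n) (F1 : 'M[R]_(1, n)) (F2 : 'M[R]_1) :
  P^T = P -> Q^T = Q -> P *m graph_mx K = col_mx Q 0 -> M = block_mx H1 H2 F1 F2 ->
  negdef_mx (P *m M + M^T *m P) ->
  negdef_mx (Q *m (H1 + H2 *m K) + (H1 + H2 *m K)^T *m Q).
Proof.
move=> PT QT PE ME [_ Hneg].
have ME' : M *m graph_mx K = col_mx (H1 + H2 *m K) (F1 + F2 *m K).
  by rewrite ME /graph_mx mul_block_col !mulmx1.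
have EPME : (graph_mx K)^T *m (P *m M) *m graph_mx K = Q *m (H1 + H2 *m K).
  have -> : (graph_mx K)^T *m (P *m M) *m graph_mx K = (P *m graph_mx K)^T *m (M *m graph_mx K).
    by rewrite trmx_mul PT !mulmxA.
  by rewrite PE ME' tr_col_mx mul_row_col trmx0 mul0mx addr0 QT.
split; first by rewrite linearD /= !trmx_mul trmxK QT addrC.
move=> v v0; have := Hneg _ (graph_mx_eq0 K v0).
have <- : (graph_mx K)^T *m (P *m M + M^T *m P) *m graph_mx K =
    Q *m (H1 + H2 *m K) + (H1 + H2 *m K)^T *m Q.
  have -> : (H1 + H2 *m K)^T *m Q = (Q *m (H1 + H2 *m K))^T by rewrite trmx_mul QT.
  by rewrite mulmxDr mulmxDl -EPME !trmx_mul trmxK PT !mulmxA.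
by rewrite trmx_mul !mulmxA.
Qed.

End SchurComplement.

Section Backstepping.
Variables (R : realType) (n : nat).
Implicit Types (y : 'cV[R]_n) (chi : 'cV[R]_(n + 1)).

Lemma linear_usubmx : linear (@usubmx R n 1 1).
Proof. by move=> c u v; rewrite linearP. Qed.

Lemma Ck_usubmx (W : normedModType R) k (f : 'cV[R]_n -> W) :
  Ck k f -> Ck k (fun chi => f (usubmx chi)).
Proof.
apply: (@Ck_linear_comp _ _ _ _ k (usubmx : {linear 'cV[R]_(n + 1) -> 'cV[R]_n}) f).
exact/linear_mx_continuous/linear_usubmx.
Qed.

Lemma derive_usubmx (W : normedModType R) (f : 'cV[R]_n -> W) chi (v : 'cV[R]_(n + 1)) :
  differentiable f (usubmx chi) ->
  is_derive chi v (fun chi => f (usubmx chi)) ('D_(usubmx v) f (usubmx chi)).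
Proof.
move=> df; have uc := linear_mx_continuous linear_usubmx.
have du : differentiable (usubmx : {linear 'cV[R]_(n + 1) -> 'cV[R]_n}) chi.
  exact: linear_differentiable.
have dfu := differentiable_comp du df.
apply: DeriveDef; first exact: diff_derivable.
by rewrite deriveE // diff_comp //= diff_lin // -deriveE.
Qed.

Definition xpart chi : R := dsubmx chi 0 0.

Lemma linear_xpart : linear (xpart : 'cV[R]_(n + 1) -> R).
Proof. by move=> c u v; rewrite /xpart linearP !mxE. Qed.

Lemma is_derive_xpart chi (w : 'cV[R]_(n + 1)) : is_derive chi w xpart (xpart w).
Proof.
have xk := @Ck_linear_mx _ _ _ _ 1 _ linear_xpart.
apply: DeriveDef; first by apply: diff_derivable; exact: xk.1.
rewrite deriveE; last exact: xk.1.
pose L : {linear _ -> _} := HB.pack xpart (GRing.isLinear.Build _ _ _ _ _ linear_xpart).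
by rewrite (@diff_lin _ _ _ L) //; exact: (linear_mx_continuous linear_xpart).
Qed.

Variables (Vy phi : 'cV[R]_n -> R) (p : R).
Hypotheses (sVy : smooth Vy) (pVy : proper_fun Vy) (pdVy : posdef_fun Vy).
Hypotheses (sphi : smooth phi) (phi0 : phi 0 = 0) (p0 : 0 < p).

Definition gap chi : R := xpart chi - phi (usubmx chi).

Definition backstep chi : R := Vy (usubmx chi) + p * (gap chi * gap chi).

Lemma smooth_gap : smooth gap.
Proof.
move=> k; apply: CkB; first exact/Ck_linear_mx/linear_xpart.
exact: Ck_usubmx.
Qed.

Lemma smooth_backstep : smooth backstep.
Proof.
move=> k; apply: CkD; first exact: Ck_usubmx.
by apply: CkM; [exact: Ck_cst|apply: CkM; exact: smooth_gap].
Qed.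

Lemma derive_gap chi (w : 'cV[R]_(n + 1)) :
  'D_w gap chi = xpart w - 'D_(usubmx w) phi (usubmx chi).
Proof.
have d1 := is_derive_xpart chi w.
have d2 := @derive_usubmx _ phi chi w ((sphi 1).1 _).
exact: (@derive_val _ _ _ _ _ _ _ (is_deriveB d1 d2)).
Qed.

Lemma derive_backstep chi (w : 'cV[R]_(n + 1)) :
  'D_w backstep chi = 'D_(usubmx w) Vy (usubmx chi)
    + 2 * p * gap chi * (xpart w - 'D_(usubmx w) phi (usubmx chi)).
Proof.
have d1 := @derive_usubmx _ Vy chi w ((sVy 1).1 _).
have dg : is_derive chi w gap ('D_w gap chi).
  by apply: derivableP; apply: diff_derivable; exact: (smooth_gap 1).1.
have d2 := is_deriveD d1 (is_deriveZ p (is_deriveM dg dg)).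
have -> := @derive_val _ _ _ _ _ _ _ d2.
rewrite derive_gap; congr (_ + _); rewrite -[LHS]/(p * (_ * _ + _ * _)); ring.
Qed.

Lemma posdef_backstep : posdef_fun backstep.
Proof.
have [Vy0 Vyp] := pdVy.
split.
  rewrite /backstep /gap /xpart !linear0 phi0 Vy0 mxE subr0; ring.
move=> chi chi0; have [y0|y0] := eqVneq (usubmx chi) 0; last first.
  by rewrite /backstep ltr_pwDl ?Vyp // mulr_ge0 ?(ltW p0) // -expr2 sqr_ge0.
rewrite /backstep y0 Vy0 add0r mulr_gt0 // -expr2 exprn_even_gt0 //=.
rewrite /gap y0 phi0 subr0; apply: contra chi0 => /eqP x0.
rewrite -[chi]vsubmxK y0 [dsubmx chi]mx11_scalar -/(xpart chi) x0.
by rewrite raddf0 col_mx0.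
Qed.

(** Below a level of the sum, y stays in a compact sublevel set of Vy, on which
    phi is bounded, and x stays close to phi(y). *)
Lemma proper_backstep : proper_fun backstep.
Proof.
move=> K cK.
have Bc : continuous backstep := smooth_backstep 0.
have [c Hc] : exists c, forall t, K t -> t <= c.
  have /compact_bounded[M [_ HM]] := cK.
  exists (M + 1) => t Kt; apply: le_trans (ler_norm _) _; apply: (HM (M + 1)) => //.
  by rewrite ltrDl.
have [cA [M HM]] := proper_bounded c pVy pdVy.
have [N HN] : exists N : R, forall y, Vy y <= c -> `|phi y| <= N.
  have /compact_bounded[N [_ HN]] := continuous_compact (continuous_subspaceT (sphi 0)) cA.
  exists (N + 1) => y yc; apply: (HN (N + 1)); first by rewrite ltrDl.
  by exists y.
apply: (@bounded_closed_compact_cV _ _ _ (Num.max M (N + (1 + c / p)))); last first.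
  by apply: closed_comp => [x _|]; [exact: Bc|exact: compact_closed].
move=> chi /= /Hc; rewrite /backstep => Bchi.
have Vyge0 y : 0 <= Vy y by have [->|/pdVy.2/ltW//] := eqVneq y 0; rewrite pdVy.1.
have g0 : 0 <= p * (gap chi * gap chi) by rewrite mulr_ge0 ?(ltW p0) // -expr2 sqr_ge0.
have yc : Vy (usubmx chi) <= c by lra.
have gc : gap chi * gap chi <= c / p.
  by rewrite ler_pdivlMr // mulrC; have := Vyge0 (usubmx chi); lra.
have gb : `|gap chi| <= 1 + c / p.
  rewrite leNgt; apply/negP => H.
  have c0 : 0 <= c / p by apply: le_trans gc; rewrite -expr2 sqr_ge0.
  have : `|gap chi| * `|gap chi| <= c / p by rewrite -normrM ger0_norm // -expr2 sqr_ge0.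
  nra.
have xb : `|xpart chi| <= N + (1 + c / p).
  have -> : xpart chi = phi (usubmx chi) + gap chi by rewrite /gap addrC subrK.
  by apply: le_trans (ler_normD _ _) _; apply: lerD => //; exact: HN.
have M0 : 0 <= Num.max M (N + (1 + c / p)).
  by rewrite le_max; apply/orP; right; apply: le_trans xb.
rewrite [leLHS]/Num.Def.normr /= mx_normrE; apply: bigmax_le => // -[i j] _ /=.
rewrite (ord1 j) le_max -(fintype.splitK i); case: (fintype.split i) => k /=; apply/orP;
  [left|right].
  apply: le_trans (HM _ yc); have := coord_le_norm (usubmx chi) k 0.
  by rewrite mxE.
by apply: le_trans xb; rewrite /xpart mxE (ord1 k).
Qed.

(** At the origin the gap vanishes, so the second derivative of its square only
    involves its linear part x - K y; this reassembles the decomposition of P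
    by [schur_complement]. *)
Lemma hessian_backstep (P : 'M[R]_(n + 1)) (Q : 'M[R]_n) (K : 'rV[R]_n) :
  hessian Vy 0 = 2 *: Q -> (forall v, 'D_v phi 0 = (K *m v) 0 0) ->
  (forall v w : 'cV[R]_(n + 1), (v^T *m P *m w) 0 0 =
      ((usubmx v)^T *m Q *m usubmx w) 0 0 +
      p * ((dsubmx v 0 0 - (K *m usubmx v) 0 0) * (dsubmx w 0 0 - (K *m usubmx w) 0 0))) ->
  hessian backstep 0 = 2 *: P.
Proof.
move=> hV dphi HP.
have key (v w : 'cV[R]_(n + 1)) :
    'D_v (fun b => 'D_w backstep b) 0 = 2 * (v^T *m P *m w) 0 0.
  rewrite HP (_ : (fun b => _) = fun b => 'D_(usubmx w) Vy (usubmx b)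
    + 2 * p * gap b * (xpart w - 'D_(usubmx w) phi (usubmx b))); last first.
    by apply: funext => b; exact: derive_backstep.
  have d1 := @derive_usubmx _ (fun b => 'D_(usubmx w) Vy b) 0 v (((sVy 2).2 _).1 _).
  have d2 := @derive_usubmx _ (fun b => 'D_(usubmx w) phi b) 0 v (((sphi 2).2 _).1 _).
  have dg : is_derive 0 v gap ('D_v gap 0).
    by apply: derivableP; apply: diff_derivable; exact: (smooth_gap 1).1.
  have d3 := is_deriveD d1 (is_deriveM (is_deriveZ (2 * p) dg)
    (is_deriveB (is_derive_cst (xpart w) 0 v) d2)).
  have -> := @derive_val _ _ _ _ _ _ _ d3.
  rewrite derive_gap linear0 !dphi hessianE // hV.
  have g00 : gap 0 = 0 by rewrite /gap /xpart !linear0 phi0 mxE subr0.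
  have -> : ((2 * p) \*: gap) 0 = 0 by rewrite -[LHS]/(2 * p * gap 0) g00 mulr0.
  have -> : (cst (xpart w) - (fun chi => 'D_(usubmx w) phi (usubmx chi))) 0
      = xpart w - (K *m usubmx w) 0 0.
    by rewrite -[LHS]/(xpart w - 'D_(usubmx w) phi (usubmx 0)) linear0 dphi.
  rewrite scale0r add0r -scalemxAr -scalemxAl [X in X + _]mxE.
  rewrite -[_ *: _]/(_ * (2 * p * _)) /xpart; ring.
apply/matrixP => i j; rewrite mxE key -colE [col _ _ _ _]mxE trmx_delta -rowE mxE.
by rewrite [RHS]mxE.
Qed.

End Backstepping.


Section ClosedLoop.
Variables (R : realType) (ny p : nat).
Variables (h1 h2 : 'cV[R]_ny -> 'cV[R]_ny).
Variables (f : 'cV[R]_(ny + 1) -> R) (g : 'cV[R]_(ny + 1) -> 'rV[R]_p).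
Hypotheses (h1_C1 : Ck 1 h1) (h2_C1 : Ck 1 h2) (f_C1 : Ck 1 f) (g_C1 : Ck 1 g).
Hypotheses (h1_0 : h1 0 = 0) (f_0 : f 0 = 0).

Lemma Ck_system (alpha : 'cV[R]_(ny + 1) -> 'cV[R]_p) : Ck 1 alpha ->
  Ck 1 (fun chi => system h1 h2 f g chi (alpha chi)).
Proof.
move=> Ha; apply: Ck_col_mx.
  apply: CkD; first exact: Ck_usubmx.
  apply: CkZ; last exact: Ck_usubmx.
  exact/Ck_linear_mx/linear_xpart.
apply: Ck_mx => i j; under eq_fun do rewrite mxE.
rewrite (ord1 i) (ord1 j) eqxx.
exact: (CkD f_C1 (Ck_coord 0 0 (Ck_mulmx g_C1 Ha))).
Qed.

Lemma system0 (alpha : 'cV[R]_(ny + 1) -> 'cV[R]_p) : alpha 0 = 0 ->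
  system h1 h2 f g 0 (alpha 0) = 0.
Proof.
move=> ->; rewrite /system !linear0 h1_0 f_0 !mxE scale0r !addr0.
by rewrite raddf0 col_mx0.
Qed.

Lemma sysAB_mul (K : 'M[R]_(p, ny + 1)) (v : 'cV[R]_(ny + 1)) :
  (sysA h1 h2 f + sysB g *m K) *m v =
  col_mx (jac h1 0 *m usubmx v + xpart v *: h2 0)
    ((grad f 0 *m v) 0 0 + (g 0 *m (K *m v)) 0 0)%:M.
Proof.
have -> : sysB g *m K = col_mx 0 (g 0 *m K) by rewrite /sysB mul_col_mx mul0mx.
rewrite mulmxDl.
have -> : sysA h1 h2 f *m v = col_mx (jac h1 0 *m usubmx v + h2 0 *m dsubmx v)
    (lsubmx (grad f 0) *m usubmx v + rsubmx (grad f 0) *m dsubmx v).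
  by rewrite -{1}[v]vsubmxK /sysA mul_block_col.
rewrite mul_col_mx mul0mx add_col_mx addr0; congr col_mx.
  by rewrite {1}[dsubmx v]mx11_scalar mul_mx_scalar.
rewrite -mul_row_col hsubmxK vsubmxK -mulmxA [LHS]mx11_scalar; congr (_%:M).
by rewrite mxE.
Qed.

(** The equilibrium input is zero, which removes the derivatives of g. *)
Lemma jac_system0 (alpha : 'cV[R]_(ny + 1) -> 'cV[R]_p) :
  Ck 1 alpha -> alpha 0 = 0 ->
  jac (fun chi => system h1 h2 f g chi (alpha chi)) 0 = sysA h1 h2 f + sysB g *m jac alpha 0.
Proof.
move=> Ha a0; set F := fun chi => _.
have dF := (Ck_system Ha).1 0.
suff H v : 'D_v F 0 = (sysA h1 h2 f + sysB g *m jac alpha 0) *m v.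
  by apply/matrixP => i j; rewrite mxE H -colE mxE.
have u0 : usubmx (0 : 'cV[R]_(ny + 1)) = 0 by rewrite linear0.
rewrite sysAB_mul derive_mx; last exact: diff_derivable.
apply/matrixP => i j; rewrite (ord1 j) mxE -(fintype.splitK i).
case: (fintype.split i) => l /=.
  under eq_fun do rewrite /F /system col_mxEu mxE [X in _ + X]mxE.
  have c1 := Ck_usubmx h1_C1; have c2 := Ck_usubmx h2_C1.
  have d1 := is_derive_coord v l 0 (c1.1 0).
  have d2 := is_derive_coord v l 0 (c2.1 0).
  have d := is_deriveD d1 (is_deriveM (is_derive_xpart 0 v) d2).
  rewrite col_mxEu; have -> := @derive_val _ _ _ _ _ _ _ d.
  have -> : 'D_v (fun chi : 'cV_(ny + 1) => h1 (usubmx chi)) 0 = jac h1 0 *m usubmx v.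
    have := @derive_val _ _ _ _ _ _ _ (derive_usubmx (chi := 0) v (h1_C1.1 _)).
    by move=> ->; rewrite u0 derive_jac //; exact: h1_C1.1.
  have x0 : xpart (0 : 'cV[R]_(ny + 1)) = 0 by rewrite /xpart linear0 mxE.
  by rewrite x0 scale0r add0r u0 [RHS]mxE [X in _ = _ + X]mxE mulrC.
rewrite (ord1 l); under eq_fun do rewrite /F /system col_mxEd mxE eqxx.
rewrite col_mxEd [RHS]mxE eqxx.
have dk (k : 'I_p) : is_derive 0 v (fun chi => g chi 0 k * alpha chi k 0)
    (g 0 0 k * (jac alpha 0 *m v) k 0).
  have dg := is_derive_coord v 0 k (g_C1.1 0).
  have da := is_derive_coord v k 0 (Ha.1 0).
  apply: (is_derive_eq (is_deriveM dg da)).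
  by rewrite a0 [X in _ + X *: _]mxE scale0r addr0 derive_jac //; exact: Ha.1.
have df : is_derive 0 v f ((grad f 0 *m v) 0 0).
  rewrite -derive_grad; last exact: f_C1.1.
  by apply: derivableP; apply: diff_derivable; exact: f_C1.1.
have d := is_deriveD df (is_derive_sum dk).
rewrite (_ : (fun chi => _) = f + \sum_k (fun chi => g chi 0 k * alpha chi k 0)); last first.
  by apply: funext => chi; rewrite mxE -[RHS]/(f chi + _ chi) fct_sumE.
by rewrite (@derive_val _ _ _ _ _ _ _ d) [X in _ = _ + X]mxE.
Qed.

End ClosedLoop.

(** * The closed loop with prescribed local behaviour *)

Section Prescribed.
Variable R : realType.

Lemma lie_add_scale n (h1 h2 : 'cV[R]_n -> 'cV[R]_n) (c : 'cV[R]_n -> R) V y :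
  lie (fun y => h1 y + c y *: h2 y) V y = lie h1 V y + c y * lie h2 V y.
Proof. by rewrite /lie mulmxDr -scalemxAr mxE [X in _ + X]mxE. Qed.

(** Selection for the y-subsystem, in which x plays the part of a scalar input:
    the gain K works near the origin, by [local_decrease], and the assumption on
    V says that some input works at every other point. *)
Lemma smooth_virtual_control n (h1 h2 : 'cV[R]_n -> 'cV[R]_n) (V : 'cV[R]_n -> R)
    (K : 'rV[R]_n) (Q : 'M[R]_n) :
  Ck 1 h1 -> Ck 1 h2 -> h1 0 = 0 -> smooth V -> posdef_fun V -> hessian V 0 = 2 *: Q ->
  Q^T = Q -> negdef_mx (Q *m (jac h1 0 + h2 0 *m K) + (jac h1 0 + h2 0 *m K)^T *m Q) ->
  (forall y, y <> 0 -> lie h2 V y = 0 -> lie h1 V y < 0) ->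
  exists phi : 'cV[R]_n -> R,
    [/\ smooth phi, phi 0 = 0, forall v, 'D_v phi 0 = (K *m v) 0 0 &
      forall y, y != 0 -> lie h1 V y + phi y * lie h2 V y < 0].
Proof.
move=> h1_1 h2_1 h1_0 sV pV hV QT nd clf.
pose F y := h1 y + (K *m y) 0 0 *: h2 y.
have Kc k : Ck k (fun y : 'cV[R]_n => (K *m y) 0 0) by apply: Ck_coord; exact: Ck_mulmxl.
have F1 : Ck 1 F := CkD h1_1 (CkZ (Kc 1%N) h2_1).
have F0 : F 0 = 0 by rewrite /F h1_0 mulmx0 mxE scale0r addr0.
have jF : jac F 0 = jac h1 0 + h2 0 *m K.
  suff H v : 'D_v F 0 = (jac h1 0 + h2 0 *m K) *m v.
    by apply/matrixP => i j; rewrite mxE H -colE mxE.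
  rewrite derive_mx; last by apply: diff_derivable; exact: F1.1.
  apply/matrixP => i j; rewrite (ord1 j) mxE.
  under eq_fun do rewrite /F mxE [X in _ + X]mxE.
  have d1 := is_derive_coord v i 0 (h1_1.1 0).
  have d2 := is_derive_coord v i 0 (h2_1.1 0).
  have dK := is_derive_coord v 0 0 ((Ck_mulmxl 1 K).1 0).
  have d := is_deriveD d1 (is_deriveM dK d2).
  have -> := @derive_val _ _ _ _ _ _ _ d.
  rewrite derive_mulmxl.
  rewrite mulmx0 [X in X *: _]mxE scale0r add0r derive_jac; last exact: h1_1.1.
  rewrite mulmxDl [RHS]mxE; congr (_ + _).
  by rewrite -mulmxA [in RHS](mx11_scalar (K *m v)) mul_mx_scalar [RHS]mxE mulrC.
have [r r0 Hr] := local_decrease (sV 2) pV hV (F1.1 0) F0 jF nd QT.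
pose b y : 'rV[R]_1 := (lie h2 V y)%:M.
have V1 := sV 1.
have ac : continuous (lie h1 V) by apply: continuous_lie => //; exact: Ck_continuous h1_1.
have bc : continuous b.
  have lc : Ck 0 (lie h2 V) by apply: continuous_lie => //; exact: Ck_continuous h2_1.
  apply: (@Ck_mx _ _ _ _ 0) => i j.
  by under eq_fun do rewrite mxE (ord1 i) (ord1 j) eqxx.
have bE y (u : 'cV[R]_1) : (b y *m u) 0 0 = u 0 0 * lie h2 V y.
  by rewrite /b mul_scalar_mx mxE mulrC.
have [|y y0 by0|beta [sb nb db]] := smooth_selection ac bc r0 (K := K).
- move=> y y0 yr; rewrite bE; have := Hr y y0 yr.
  by rewrite /F lie_add_scale.
- apply: clf; first exact/eqP.
  by have := congr1 (fun X : 'rV[R]_1 => X 0 0) by0; rewrite !mxE eqxx.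
exists (fun y => beta y 0 0); split.
- by move=> k; exact/Ck_coord/sb.
- by rewrite (nbhs_singleton nb) mulmx0 mxE.
- move=> v; have := is_derive_coord v 0 0 ((sb 1).1 0) => db0.
  by have -> := @derive_val _ _ _ _ _ _ _ db0; rewrite (derive_near_linear _ nb).
by move=> y y0; have := db y y0; rewrite bE.
Qed.

End Prescribed.

Section Gain.
Variables (R : realType) (ny p : nat).
Variables (h1 h2 : 'cV[R]_ny -> 'cV[R]_ny).
Variables (f : 'cV[R]_(ny + 1) -> R) (g : 'cV[R]_(ny + 1) -> 'rV[R]_p).

Lemma closed_loop_block (K : 'M[R]_(p, ny + 1)) : exists F1 F2,
  sysA h1 h2 f + sysB g *m K = block_mx (jac h1 0) (h2 0) F1 F2.
Proof.
exists (lsubmx (grad f 0) + lsubmx (g 0 *m K)), (rsubmx (grad f 0) + rsubmx (g 0 *m K)).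
have -> : sysB g *m K = block_mx 0 0 (lsubmx (g 0 *m K)) (rsubmx (g 0 *m K)).
  by rewrite /sysB mul_col_mx mul0mx /block_mx hsubmxK row_mx0.
by rewrite /sysA add_block_mx !addr0.
Qed.

(** The input only acts on the last coordinate, along which the derivative of
    the backstepping function is 2 c gap. *)
Lemma lie_backstep (Vy phi : 'cV[R]_ny -> R) (c : R) (u : 'cV[R]_(ny + 1) -> 'cV[R]_p) chi :
  smooth Vy -> smooth phi ->
  lie (fun chi => system h1 h2 f g chi (u chi)) (backstep Vy phi c) chi =
    lie (fun chi => system h1 h2 f g chi 0) (backstep Vy phi c) chi
    + (((2 * c * gap phi chi) *: g chi) *m u chi) 0 0.
Proof.
move=> sV sphi.
have dV := (smooth_backstep c sV sphi 1).1 chi.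
have xE (w : 'cV[R]_p) : xpart (system h1 h2 f g chi w) = f chi + (g chi *m w) 0 0.
  by rewrite /xpart /system col_mxKd [LHS]mxE eqxx.
have uE (w : 'cV[R]_p) : usubmx (system h1 h2 f g chi w) =
    h1 (usubmx chi) + xpart chi *: h2 (usubmx chi) by exact: col_mxKu.
have -> : (((2 * c * gap phi chi) *: g chi) *m u chi) 0 0 =
  2 * c * gap phi chi * (g chi *m u chi) 0 0.
  by rewrite -scalemxAl mxE.
rewrite !lieE // -!deriveE // !derive_backstep // !xE !uE mulmx0 [_ 0 0 in RHS]mxE; ring.
Qed.

End Gain.

Theorem theorem4 (R : realType) (ny p : nat)
    (h1 h2 : 'cV[R]_ny -> 'cV[R]_ny)
    (f : 'cV[R]_(ny + 1) -> R) (g : 'cV[R]_(ny + 1) -> 'rV[R]_p)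
    (h1_C1 : Ck 1 h1) (h2_C1 : Ck 1 h2) (f_C1 : Ck 1 f) (g_C1 : Ck 1 g)
    (h1_0 : h1 0 = 0) (f_0 : f 0 = 0) (g_neq0 : forall chi, g chi <> 0)
    (HV : forall (Ky : 'rV[R]_ny) (Py : 'M[R]_ny),
      posdef_mx Py ->
      negdef_mx (Py *m (jac h1 0 + h2 0 *m Ky)
                 + (jac h1 0 + h2 0 *m Ky)^T *m Py) ->
      exists Vy : 'cV[R]_ny -> R,
        [/\ smooth Vy, proper_fun Vy, posdef_fun Vy,
            hessian Vy 0 = 2 *: Py &
            forall y, y <> 0 -> lie h2 Vy y = 0 -> lie h1 Vy y < 0])
    (Ko : 'M[R]_(p, ny + 1))
    (hKo : hurwitz (sysA h1 h2 f + sysB g *m Ko)) :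
  exists alpha : 'cV[R]_(ny + 1) -> 'cV[R]_p,
    smooth alpha /\ prescribed_local_GAS h1 h2 f g Ko alpha.
Proof.
have [P [pdP ndP]] := lyapunov_equation hKo.
have [K [Q [c [c0 pdQ PE HP]]]] := schur_complement pdP.
have [F1 [F2 Mblock]] := closed_loop_block h1 h2 f g Ko.
have ndQ := schur_complement_negdef pdP.1 pdQ.1 PE Mblock ndP.
have [Vy [sV pV pdV hV clf]] := HV K Q pdQ ndQ.
have [phi [sphi phi0 dphi dec]] :=
  smooth_virtual_control h1_C1 h2_C1 h1_0 sV pdV hV pdQ.1 ndQ clf.
pose V := backstep Vy phi c.
have sW : smooth V by exact: smooth_backstep.
have pdW : posdef_fun V by exact: posdef_backstep.
have pW : proper_fun V by exact: proper_backstep.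
have hW : hessian V 0 = 2 *: P by exact: (hessian_backstep sV sphi phi0 hV dphi HP).
pose FK chi := system h1 h2 f g chi (Ko *m chi).
have FK1 : Ck 1 FK by apply: Ck_system => //; exact: Ck_mulmxl.
have FK0 : FK 0 = 0 by apply: (system0 h2 g h1_0 f_0 (alpha := fun chi => Ko *m chi));
  exact: mulmx0.
have jFK : jac FK 0 = sysA h1 h2 f + sysB g *m Ko.
  rewrite /FK (jac_system0 h1_C1 h2_C1 f_C1 g_C1 (alpha := fun chi => Ko *m chi)) //.
  - by congr (_ + _ *m _); apply/matrixP => i j; rewrite mxE derive_mulmxl -colE mxE.
  - exact: Ck_mulmxl.
  - exact: mulmx0.
(* Near the origin the linear feedback decreases V, since V has Hessian 2P. *)
have [r r0 Hr] := local_decrease (sW 2) pdW hW (FK1.1 0) FK0 jFK ndP pdP.1.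
pose a := lie (fun chi => system h1 h2 f g chi 0) V.
pose b chi := (2 * c * gap phi chi) *: g chi.
have ac : continuous a.
  apply: continuous_lie; last exact: sW.
  by apply: (@Ck_continuous _ _ _ 1); apply: Ck_system => //; exact: Ck_cst.
have bc : continuous b.
  apply: (@CkZ _ _ _ _ 0); last exact: CkW.
  by apply: CkM; [exact: Ck_cst|exact: smooth_gap].
have [|chi chi0 b0|alpha [sa na da]] := smooth_selection ac bc r0 (K := Ko).
- move=> chi chi0 chir; have := Hr chi chi0 chir.
  by rewrite /FK lie_backstep.
(* g does not vanish, so the input is powerless exactly where x = phi(y);
   there V decreases like Vy does along the y-subsystem driven by phi. *)
- have g0 : gap phi chi = 0.
    move/eqP: b0; rewrite scaler_eq0 => /orP[|/eqP/g_neq0//].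
    by rewrite !mulf_eq0 pnatr_eq0 (gt_eqF c0) /= => /eqP.
  rewrite /a lieE; last exact: (sW 1).1.
  rewrite -deriveE; last exact: (sW 1).1.
  rewrite derive_backstep // g0 mulr0 mul0r addr0 col_mxKu.
  have xphi : xpart chi = phi (usubmx chi) by apply/eqP; rewrite -subr_eq0 -/(gap phi chi) g0.
  have y0 : usubmx chi != 0.
    apply: contra chi0 => /eqP y0; move: xphi; rewrite y0 phi0 => x0.
    rewrite -[chi]vsubmxK y0 [dsubmx chi]mx11_scalar -/(xpart chi) x0.
    by rewrite raddf0 col_mx0.
  have := dec _ y0; rewrite -/(xpart chi) xphi.
  rewrite -(lie_add_scale h1 h2 phi) lieE; last exact: (sV 1).1.
  by rewrite -deriveE //; exact: (sV 1).1.
exists alpha; split=> //; split; last exact: jac_near_linear.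
have a0 : alpha 0 = 0 by rewrite (nbhs_singleton na) mulmx0.
have F_C1 := Ck_system h1_C1 h2_C1 f_C1 g_C1 (sa 1).
have F_0 := system0 h2 g h1_0 f_0 a0.
apply: (gas_of_lyapunov F_C1 F_0 (sW 1) pW pdW) => chi chi0.
by rewrite lie_backstep //; exact: da.
Qed.
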